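(* Let $\Gamma$ be a finite connected metric graph and let $q:\Gamma\to\mathbb{R}$ be measurable and bounded with $q(x)\ge0$ for almost all $x\in\Gamma$. Then the following statements are equivalent. (i) The perturbed Krein Laplacian and the perturbed standard Laplacian coincide, i.e. $-\Delta_{{\rm K},\Gamma,q}=-\Delta_{{\rm st},\Gamma,q}$; (ii) $\Gamma$ is a flower graph and $q=0$ identically.
   Context: A finite metric graph $\Gamma$ consists of a finite vertex set $\mathcal{V}$, a finite nonempty edge set $\mathcal{E}$ (loops and multiple edges allowed) and a length function $\ell:\mathcal{E}\to(0,\infty)$. A flower graph is a graph with exactly one vertex (all edges are loops attached to it). Each edge $e$ is identified with $[0,\ell(e)]$, its two endpoints corresponding to the (possibly equal) vertices incident with $e$. A function $f$ on $\Gamma$ is a collection $(f_e)_{e\in\mathcal{E}}$ of functions $f_e:(0,\ell(e))\to\mathbb{C}$; $f\in L^2(\Gamma)$ means $f_e\in L^2(0,\ell(e))$ for all $e$. $\widetilde H^k(\Gamma)$ is the set of $f\in L^2(\Gamma)$ with $f_e\in H^k(0,\ell(e))$ for all $e$; $H^1(\Gamma)$ is the set of $f\in\widetilde H^1(\Gamma)$ that are continuous at each vertex (all traces at endpoints corresponding to the same vertex $v$ coincide; the common value is $f(v)$). For $f\in\widetilde H^2(\Gamma)$ and $v\in\mathcal{V}$, $\partial_\nu f(v)$ is the sum, over all edge endpoints located at $v$ (both endpoints of a loop at $v$ are counted), of the derivative of $f_e$ at that endpoint taken in the direction pointing towards $v$ (i.e. $f_e'(\ell(e))$ for the endpoint $\ell(e)$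 and $-f_e'(0)$ for the endpoint $0$). All operators below act in $L^2(\Gamma)$ as $f\mapsto(-f_e''+q_ef_e)_{e\in\mathcal{E}}$. $S$ has domain $\{f\in\widetilde H^2(\Gamma)\cap H^1(\Gamma): f(v)=\partial_\nu f(v)=0\ \forall v\in\mathcal{V}\}$; it is closed, symmetric, densely defined with a positive lower bound. $S^*$ has domain $\widetilde H^2(\Gamma)\cap H^1(\Gamma)$. The perturbed standard Laplacian $-\Delta_{{\rm st},\Gamma,q}$ has domain $\{f\in\widetilde H^2(\Gamma)\cap H^1(\Gamma):\partial_\nu f(v)=0\ \forall v\}$; the perturbed Krein Laplacian $-\Delta_{{\rm K},\Gamma,q}$ is the Krein–von Neumann extension of $S$, i.e. the self-adjoint restriction of $S^*$ to $\operatorname{dom}S\dotplus\ker S^*$. The phrase ''$q=0$ identically'' is understood in the almost-everywhere sense. *)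

(* Defs.v *)
From HB Require Import structures.
From mathcomp Require Import all_boot all_order all_algebra.
From mathcomp Require Import complex.
From mathcomp Require Import all_classical all_reals all_analysis measurable_realfun.

Set Implicit Arguments.
Unset Strict Implicit.
Unset Printing Implicit Defensive.
Import Order.TTheory GRing.Theory Num.Theory numFieldNormedType.Exports.

Local Open Scope classical_set_scope.
Local Open Scope ring_scope.

(* Functions on (0, l) are encoded as functions on the whole of R whose values
   outside (0, l) are never used, and elements of L^2 by representatives: every
   notion below depends only on the class modulo equality almost everywhere
   on (0, l). *)
Section Interval.
Variable R : realType.
Local Notation mu := (@lebesgue_measure R).
Implicit Types (l : R) (f g : R -> R[i]).

Definition edge_int l : set R := `]0, l[%classic.

Definition aeq l f g := ae_eq mu (edge_int l) f g.

Definition cintegral l f : R[i] :=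
  Complex (Rintegral mu (edge_int l) (fun x => complex.Re (f x)))
          (Rintegral mu (edge_int l) (fun x => complex.Im (f x))).

(* Measurability is Borel measurability, which is no restriction on classes:
   every Lebesgue measurable function is a.e. equal to a Borel one. *)
Definition L2 l f : Prop :=
  [/\ measurable_fun (edge_int l) (fun x => complex.Re (f x)),
      measurable_fun (edge_int l) (fun x => complex.Im (f x)) &
      (\int[mu]_(x in edge_int l)
         ((complex.Re (f x)) ^+ 2 + (complex.Im (f x)) ^+ 2)%:E < +oo)%E].

Definition test_fun l (phi : R -> R) : Prop :=
  (forall n x, derivable (derive1n n phi) x 1) /\
  exists a b, [/\ 0 < a, b < l & forall x, ~~ (a <= x <= b) -> phi x = 0].

Definition is_wderiv l (n : nat) f g : Prop :=
  L2 l g /\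
  forall phi, test_fun l phi ->
    cintegral l (fun x => f x * (derive1n n phi x)%:C%C) =
    (-1) ^+ n * cintegral l (fun x => g x * (phi x)%:C%C).

Definition sobolev l (k : nat) f : Prop :=
  L2 l f /\ forall j, (j <= k)%N -> exists g, is_wderiv l j f g.

(* Some representative of the n-th weak derivative; junk (0) if there is none. *)
Definition wderiv l (n : nat) f : R -> R[i] :=
  xget (fun=> 0) [set g | is_wderiv l n f g].

(* The trace of f in H^1(0, l) at the endpoint l (b = true) or 0 (b = false) is
   the value there of the representative of f that is continuous on [0, l]. *)
Definition is_trace l (b : bool) f (a : R[i]) : Prop :=
  exists h : R -> R[i],
    [/\ {within `[0, l], continuous (fun x => complex.Re (h x))},
        {within `[0, l], continuous (fun x => complex.Im (h x))},
        aeq l h f & h (if b then l else 0) = a].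

Definition trace l b f : R[i] := xget 0 [set a | is_trace l b f a].

(* Lebesgue (not only Borel) measurability of a real function on (0, l) *)
Definition lebesgue_measurable_on l (u : R -> R) : Prop :=
  @measurable_fun _ _ (g_sigma_algebraType (completed_algebra_gen mu))
    (measurableTypeR R) (edge_int l) u.

End Interval.

Record metric_graph (R : realType) := MetricGraph {
  vertex : finType;
  edge : finType;
  edge_gt0 : (0 < #|edge|)%N;
  len : edge -> R;
  len_gt0 : forall e, 0 < len e;
  endpt : edge * bool -> vertex
    (* (e, false) and (e, true) are the endpoints 0 and len e of the edge e *)
}.

Arguments edge {R} m.
Arguments vertex {R} m.
Arguments endpt {R m} p.
Arguments len {R m} e.

Section Graph.
Variables (R : realType) (G : metric_graph R).

Definition adjacent : rel (vertex G) := fun v w =>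
  [exists e : edge G, ((endpt (e, false) == v) && (endpt (e, true) == w)) ||
                      ((endpt (e, false) == w) && (endpt (e, true) == v))].

Definition graph_connected : Prop := forall v w, connect adjacent v w.

Definition flower : Prop := #|vertex G| = 1%N.

Definition gfun := edge G -> R -> R[i].

Definition gL2 (f : gfun) : Prop := forall e, L2 (len e) (f e).

Definition gaeq (f g : gfun) : Prop := forall e, aeq (len e) (f e) (g e).

Definition inner (f g : gfun) : R[i] :=
  \sum_e cintegral (len e) (fun x => f e x * conjc (g e x)).

Definition gsobolev (k : nat) (f : gfun) : Prop :=
  forall e, sobolev (len e) k (f e).

Definition gtrace (p : edge G * bool) (f : gfun) : R[i] :=
  trace (len p.1) p.2 (f p.1).

Definition gH1 (f : gfun) : Prop :=
  gsobolev 1 f /\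
  forall p p' : edge G * bool, endpt p = endpt p' -> gtrace p f = gtrace p' f.

Definition vanishes_at (f : gfun) (v : vertex G) : Prop :=
  forall p : edge G * bool, endpt p = v -> gtrace p f = 0.

Definition gwderiv (n : nat) (f : gfun) : gfun := fun e => wderiv (len e) n (f e).

Definition normal_deriv (f : gfun) (v : vertex G) : R[i] :=
  \sum_(p : edge G * bool | endpt p == v)
    (if p.2 then gtrace p (gwderiv 1 f) else - gtrace p (gwderiv 1 f)).

(* A linear operator in L^2 is given by its graph, a set of pairs of
   representatives closed under almost everywhere equality. *)
Definition L2_operator := set (gfun * gfun).

Definition op_dom (A : L2_operator) : set gfun := [set f | exists g, A (f, g)].

Definition op_ker (A : L2_operator) : set gfun := [set f | A (f, fun _ _ => 0)].

Definition adjoint (A : L2_operator) : L2_operator :=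
  [set p | [/\ gL2 p.1, gL2 p.2 &
           forall f g, A (f, g) -> inner g p.1 = inner f p.2]].

Definition krein_extension (A : L2_operator) : L2_operator :=
  [set p | adjoint A p /\
     exists s k, [/\ op_dom A s, op_ker (adjoint A) k &
                     gaeq p.1 (fun e x => s e x + k e x)]].

Variable q : edge G -> R -> R.

Definition schroedinger (D : set gfun) : L2_operator :=
  [set p | [/\ D p.1, gL2 p.2 &
     gaeq p.2 (fun e x => - gwderiv 2 p.1 e x + (q e x)%:C%C * p.1 e x)]].

Definition S_op : L2_operator := schroedinger
  [set f | [/\ gsobolev 2 f, gH1 f &
               forall v, vanishes_at f v /\ normal_deriv f v = 0]].

Definition standard_laplacian : L2_operator := schroedinger
  [set f | [/\ gsobolev 2 f, gH1 f & forall v, normal_deriv f v = 0]].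

Definition krein_laplacian : L2_operator := krein_extension S_op.

End Graph.

(* Main.v *)
Require Import Defs.
From mathcomp Require Import all_boot all_order all_algebra.
From mathcomp Require Import complex.
From mathcomp Require Import all_classical all_reals all_analysis measurable_realfun.
From mathcomp Require Import ring lra.

Set Implicit Arguments.
Unset Strict Implicit.
Unset Printing Implicit Defensive.
Import Order.TTheory GRing.Theory Num.Theory numFieldNormedType.Exports.

Local Open Scope classical_set_scope.
Local Open Scope ring_scope.

(** Both extensions are restrictions of the adjoint of the minimal operator S,
    so everything rests on a description of that adjoint, [adjoint_S]: it acts
    as [f |-> - f'' + q f] on all functions that are H^2 on the edges and
    continuous at the vertices. Pairing an element of the adjoint with test
    functions on a single edge gives the differential equation in weak form;
    pairing it with cubics whose outer slopes are 1 and -1 at two edge ends that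
    share a vertex, and 0 at all others, shows that the traces at these two ends
    agree. The converse is Green's identity, [inner_symmetry].

    Suppose that the two extensions coincide. The constant 1 belongs to the
    standard domain, hence [1 = s + k] with [s] in the domain of S and [k] in
    the kernel of its adjoint. At every vertex [k] has trace 1 and normal
    derivative 0, so the energy of [k], the integral of [|k'|^2 + q |k|^2],
    which Green's identity turns into a sum over the vertices, is zero. Hence
    [k] is the constant 1 and [q] vanishes ([krein_standard_potential]). Then
    the function that is affine on the edges and is the indicator of a vertex
    [v] on the vertices lies in the kernel of the adjoint, so in the Krein
    domain, so in the standard domain; but its normal derivative at [v] is the
    sum of [1 / len e] over the ends at [v] of edges that are not loops. All
    edges are therefore loops ([krein_standard_loops]), and a connected graph
    with this property has one vertex. Conversely, on a flower graph with
    [q = 0] the kernel of the adjoint consists of the constants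
    ([flower_kernel_normal_deriv]), and [f = (f - f(v)) + f(v)] is the Krein
    decomposition of an element [f] of the standard domain.

    The calculus used here comes down to one fact about an interval: a function
    in H^1 is almost everywhere a primitive of its weak derivative
    ([is_wderiv_primitive]). Fubini's theorem on a square cut along its diagonal
    gives integration by parts for primitives of integrable functions, and
    smooth approximations of indicator functions together with Lebesgue's
    differentiation theorem give the du Bois-Reymond lemma, by which a function
    orthogonal to all test functions is zero.

    Elements of L^2 are Borel functions while [q] is only Lebesgue measurable;
    [Borel_representative] provides a Borel potential equal to [q] almost
    everywhere, and such a replacement changes none of the operators. *)


(** * Smooth functions and test functions *)

Section Smooth.
Variable R : realType.
Implicit Types (f g phi : R -> R) (p : {poly R}).

Definition smooth f := forall n x, derivable (derive1n n f) x 1.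

Lemma derive1nSr f n : derive1n n (derive1 f) = derive1n n.+1 f.
Proof. by rewrite /derive1n iterSr. Qed.

(** A class of derivable functions that is stable under derivation consists of
    smooth functions; this avoids formulas for the higher derivatives. *)
Lemma smooth_family (F : set (R -> R)) :
  (forall f, F f -> forall x, derivable f x 1) ->
  (forall f, F f -> F (derive1 f)) -> forall f, F f -> smooth f.
Proof.
move=> dF F' f Ff n; apply: dF.
by elim: n => [//|n IH]; rewrite derive1nS; exact: F'.
Qed.

Lemma smooth_derive1 f : smooth f -> smooth (derive1 f).
Proof. by move=> sf n x; rewrite derive1nSr; exact: sf. Qed.

Lemma smooth_derivable f : smooth f -> forall x, derivable f x 1.
Proof. by move=> sf; exact: (sf 0%N). Qed.

Lemma smooth_continuous f : smooth f -> continuous f.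
Proof.
move=> sf x; apply/differentiable_continuous/derivable1_diffP.
exact: smooth_derivable.
Qed.

Lemma smooth_is_derive f x : smooth f -> is_derive x (1:R) f (derive1 f x).
Proof. by move=> sf; rewrite derive1E; apply: derivableP; exact: (sf 0%N x). Qed.

Lemma smooth_primitive f g :
  (forall x, is_derive x (1:R) f (g x)) -> smooth g -> smooth f.
Proof.
move=> fg sg.
have f'g : (derive1 f) = g.
  by apply/funext => x; rewrite derive1E; exact: derive_val.
case=> [x|n x]; first exact: ex_derive.
by rewrite -derive1nSr f'g; exact: sg.
Qed.

(** The closure of the smooth functions under affine substitutions, sums and
    products is stable under derivation, so it adds nothing to them. *)
Inductive smooth_alg : (R -> R) -> Prop :=
| smooth_alg_comp f a b : smooth f -> smooth_alg (fun x => f (a * x + b))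
| smooth_alg_cst c : smooth_alg (fun=> c)
| smooth_alg_add f g : smooth_alg f -> smooth_alg g ->
    smooth_alg (fun x => f x + g x)
| smooth_alg_mul f g : smooth_alg f -> smooth_alg g ->
    smooth_alg (fun x => f x * g x).

Lemma smooth_alg_derive f : smooth_alg f ->
  exists2 g, smooth_alg g & forall x, is_derive x (1:R) f (g x).
Proof.
elim=> {f} [f a b sf|c|f1 f2 sf1 [g1 sg1 d1] sf2 [g2 sg2 d2]
  |f1 f2 sf1 [g1 sg1 d1] sf2 [g2 sg2 d2]].
- exists (fun x => (derive1 f) (a * x + b) * a).
    apply: smooth_alg_mul; last exact: smooth_alg_cst.
    by apply: smooth_alg_comp; exact: smooth_derive1.
  move=> x; apply: (@is_derive1_comp _ f (fun x => a * x + b)).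
    by apply: DeriveDef; [exact: smooth_derivable|rewrite derive1E].
  by apply: is_derive_eq; rewrite ?scaler0 ?addr0 ?scaler1.
- by exists (fun=> 0) => [|x]; [exact: smooth_alg_cst|exact: is_derive_cst].
- exists (fun x => g1 x + g2 x) => [|x]; first exact: smooth_alg_add.
  by apply: (@is_deriveD _ _ _ f1 f2).
- exists (fun x => f1 x * g2 x + f2 x * g1 x) => [|x].
    by apply: smooth_alg_add; exact: smooth_alg_mul.
  by apply: (@is_deriveM _ _ f1 f2).
Qed.

Lemma smooth_algP f : smooth_alg f -> smooth f.
Proof.
apply: (@smooth_family smooth_alg) => {}f /smooth_alg_derive[g sg fg] => [x|].
  exact: ex_derive.
rewrite (_ : (derive1 f) = g)//.
by apply/funext => x; rewrite derive1E; exact: derive_val.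
Qed.

Lemma smooth_id_alg f : smooth f -> smooth_alg f.
Proof.
move=> sf; have -> : f = (fun x => f (1 * x + 0)).
  by apply/funext => x; rewrite mul1r addr0.
exact: smooth_alg_comp.
Qed.

(** The factor [e], which the induction halves, leaves room for one more power
    of [y]. *)
Lemma horner_le_expR p (e : R) : 0 < e ->
  exists2 C, 0 <= C & forall y, 0 <= y -> `|p.[y]| <= C * expR (e * y).
Proof.
elim/poly_ind: p e => [|p c IH] e e0.
  by exists 0 => // y _; rewrite horner0 normr0 mul0r.
have e2 : 0 < e / 2 by rewrite divr_gt0.
have [C C0 HC] := IH _ e2.
exists (C * (e / 2)^-1 + `|c|) => [|y y0].
  by rewrite addr_ge0// mulr_ge0// invr_ge0 ltW.
rewrite hornerE /= !hornerE (le_trans (ler_normD _ _))// mulrDl lerD//; last first.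
  by rewrite ler_peMr// -expR0 ler_expR mulr_ge0// ltW.
rewrite normrM (ger0_norm y0).
have -> : expR (e * y) = expR (e / 2 * y) * expR (e / 2 * y).
  by rewrite -expRD; congr expR; lra.
rewrite mulrACA ler_pM ?HC//.
rewrite ler_pdivlMl//; apply: le_trans (expR_ge1Dx _); lra.
Qed.

(** The functions P(1/x) exp(-1/x), extended by 0: a family stable under
    derivation, which contains the usual flat function for [P = 1]. *)
Definition expinv p : R -> R :=
  fun x => if 0 < x then p.[x^-1] * expR (- x^-1) else 0.

Lemma is_derive_expinv p x :
  is_derive x (1:R) (expinv p) (expinv ('X^2 * (p - deriv p)) x).
Proof.
have [x0|x0|->] := ltgtP x 0.
- rewrite {2}/expinv ltNge (ltW x0) /=.
  apply: (@near_eq_is_derive _ R R (cst 0)).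
  near=> y; rewrite /expinv ltNge ltW//=.
  by near: y; exact: lt_nbhsl.
- rewrite {2}/expinv x0.
  have xn0 : x != 0 by rewrite gt_eqF.
  have dV : is_derive x (1:R) (fun y : R => y^-1) (- x ^- 2).
    apply: DeriveDef; first exact: derivableV.
    by rewrite deriveV// derive_id /GRing.scale/= mulr1.
  have dp : is_derive x (1:R) (fun y : R => p.[y^-1]) ((deriv p).[x^-1] * (- x ^- 2)).
    exact: (@is_derive1_comp _ (horner p) (fun y : R => y^-1)).
  have de : is_derive x (1:R) (fun y : R => expR (- y^-1))
              (expR (- x^-1) * x ^- 2).
    apply: (@is_derive1_comp _ expR (fun y : R => - y^-1)).
    by apply: is_derive_eq; rewrite opprK.
  have de' : is_derive x (1:R) (fun y : R => p.[y^-1] * expR (- y^-1))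
      (('X^2 * (p - deriv p)).[x^-1] * expR (- x^-1)).
    apply: is_derive_eq.
    by rewrite !hornerE /GRing.scale /= exprVn; ring.
  apply: near_eq_is_derive de'.
  by near=> y; rewrite /expinv ifT//; near: y; exact: lt_nbhsr.
(* The difference quotient at 0 is bounded by [C |h|]: apply the bound of a
   polynomial by an exponential to [X^2 P] at [1/h]. *)
- rewrite {2}/expinv ltxx.
  have [C C0 HC] := horner_le_expR ('X^2 * p) (@ltr01 R).
  have nC : C * `|h| @[h --> (0:R)^'] --> (0:R).
    have n0 : `|h| @[h --> (0:R)^'] --> `|0 : R|.
      by apply: cvg_norm; exact: cvg_within.
    have := cvgMl_tmp (a := C) n0; rewrite normr0 mulr0. exact.
  suff H : (fun h => h^-1 *: ((expinv p \o shift 0) (h *: 1) - expinv p 0))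
      @ 0^' --> (0 : R).
    by apply: DeriveDef; [apply: cvgP H|rewrite /derive; exact/cvg_lim].
  apply: (@squeeze_cvgr _ _ _ _ (fun h => - (C * `|h|)) (fun h => C * `|h|)).
  + near=> h.
    have hn0 : h != 0 by near: h; exact: nbhs_dnbhs_neq.
    rewrite -ler_norml /GRing.scale /= mulr1 addr0 [X in _ - X]/expinv ltxx subr0.
    rewrite /expinv; case: ifPn => [h0|_]; last first.
      by rewrite mulr0 normr0 mulr_ge0.
    have /HC : 0 <= h^-1 by rewrite invr_ge0 ltW.
    rewrite hornerM hornerXn mul1r (gtr0_norm h0) !normrM.
    rewrite (ger0_norm (expR_ge0 _)) (@ger0_norm _ h^-1) ?invr_ge0 ?(ltW h0)//.
    rewrite -invfM ler_pdivrMl ?mulr_gt0// expRN => HP.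
    rewrite mulrA ler_pdivrMr ?expR_gt0// ler_pdivrMl//.
    by apply: (le_trans HP); rewrite le_eqVlt; apply/orP; left; apply/eqP; ring.
  + have := cvgN nC; rewrite oppr0. exact.
  + exact: nC.
Unshelve. all: by end_near. Qed.

Lemma smooth_expinv p : smooth (expinv p).
Proof.
apply: (@smooth_family [set expinv p | p in setT]); last by exists p.
  by move=> _ [r _ <-] x; exact/ex_derive/is_derive_expinv.
move=> _ [r _ <-]; exists ('X^2 * (r - deriv r)) => //.
apply/funext => x; rewrite derive1E.
by have /@derive_val -> := is_derive_expinv r x.
Qed.

(** Since exp(-1/t) tends to 1 at infinity, these products tend to the indicator
    function of ]a, b[; the shifts by 1 keep their supports inside ]a, b[. *)
Definition plateau (a b : R) (n : nat) : R -> R := fun x =>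
  expinv 1 (n.+1%:R * (x - a) - 1) * expinv 1 (n.+1%:R * (b - x) - 1).

Lemma expinv1_ge0 x : 0 <= expinv 1 x.
Proof. by rewrite /expinv; case: ifP => // _; rewrite hornerC mul1r expR_ge0. Qed.

Lemma expinv1_le1 x : expinv 1 x <= 1.
Proof.
rewrite /expinv; case: ifP => // x0; rewrite hornerC mul1r -expR0 ler_expR.
by rewrite oppr_le0 invr_ge0 ltW.
Qed.

Lemma smooth_plateau a b n : smooth (plateau a b n).
Proof.
apply: smooth_algP; apply: smooth_alg_mul.
  rewrite (_ : (fun x => _) = fun x => expinv 1 (n.+1%:R * x + (- n.+1%:R * a - 1))).
    by apply: smooth_alg_comp; exact: smooth_expinv.
  by apply/funext => x; congr expinv; ring.
rewrite (_ : (fun x => _) = fun x => expinv 1 (- n.+1%:R * x + (n.+1%:R * b - 1))).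
  by apply: smooth_alg_comp; exact: smooth_expinv.
by apply/funext => x; congr expinv; ring.
Qed.

Lemma plateau_ge0 a b n x : 0 <= plateau a b n x.
Proof. by rewrite mulr_ge0// expinv1_ge0. Qed.

Lemma plateau_le1 a b n x : plateau a b n x <= 1.
Proof. by rewrite mulr_ile1 ?expinv1_ge0 ?expinv1_le1. Qed.

Lemma plateau_eq0 a b n x : ~~ (a + n.+1%:R^-1 <= x <= b - n.+1%:R^-1) ->
  plateau a b n x = 0.
Proof.
have n0 : 0 < n.+1%:R :> R by rewrite ltr0n.
rewrite negb_and -!ltNge => /orP[xa|xb]; rewrite /plateau /expinv.
  rewrite [X in X * _]ifF ?mul0r//; apply/negbTE.
  by rewrite -leNgt subr_le0 -ler_pdivlMl// mulr1 lerBlDl ltW.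
rewrite [X in _ * X]ifF ?mulr0//; apply/negbTE.
by rewrite -leNgt subr_le0 -ler_pdivlMl// mulr1 lerBlDr addrC -lerBlDr ltW.
Qed.

Lemma expinv1_cvg (t : R) : 0 < t ->
  expinv 1 (n.+1%:R * t - 1) @[n --> \oo] --> (1 : R).
Proof.
move=> t0.
have big A : \forall n \near \oo, A < n.+1%:R * t - 1.
  near=> n; rewrite ltrBrDr -ltr_pdivrMr//.
  have An : (A + 1) / t <= n%:R by near: n; exact: nbhs_infty_ger.
  by apply: (le_lt_trans An); rewrite ltr_nat.
have H : expR (- (n.+1%:R * t - 1)^-1) @[n --> \oo] --> expR (- 0).
  apply: continuous_cvg; first exact: continuous_expR.
  apply: cvgN; apply/(gtr0_cvgV0 (big 0)).
  by apply/cvgryPge => A; near=> n; apply/ltW; near: n; exact: big.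
rewrite oppr0 expR0 in H.
apply: cvg_trans H; apply: near_eq_cvg; near=> n.
rewrite /expinv ifT; first by rewrite hornerC mul1r.
by near: n; exact: big.
Unshelve. all: by end_near. Qed.

Lemma plateau_cvg a b x : a < x < b -> plateau a b n x @[n --> \oo] --> (1 : R).
Proof.
move=> /andP[ax xb]; rewrite -[X in _ --> X]mulr1.
by apply: cvgM; apply: expinv1_cvg; rewrite subr_gt0.
Qed.

Lemma test_fun_plateau l a b n : 0 <= a -> b <= l -> test_fun l (plateau a b n).
Proof.
move=> a0 bl; split; first exact: smooth_plateau.
have n0 : 0 < n.+1%:R^-1 :> R by rewrite invr_gt0.
exists (a + n.+1%:R^-1), (b - n.+1%:R^-1); split; [exact: ltr_wpDl| |].
  by rewrite (lt_le_trans _ bl)// ltrBlDr ltrDl.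
by move=> x; exact: plateau_eq0.
Qed.

Lemma test_fun_derive l phi : test_fun l phi -> test_fun l (derive1 phi).
Proof.
move=> [sp [a [b [a0 bl ab]]]]; split; first exact: smooth_derive1.
exists a, b; split => // x xab; rewrite derive1E.
have /@derive_val // : is_derive x (1:R) phi 0.
apply: near_eq_is_derive (is_derive_cst (0:R) x 1).
move: xab; rewrite negb_and -!ltNge => /orP[xa|bx].
  near=> y; rewrite ab// negb_and -!ltNge; apply/orP; left.
  by near: y; exact: lt_nbhsl.
near=> y; rewrite ab// negb_and -!ltNge; apply/orP; right.
by near: y; exact: lt_nbhsr.
Unshelve. all: by end_near. Qed.

Lemma test_funD l phi psi c : test_fun l phi -> test_fun l psi ->
  test_fun l (fun x => phi x + c * psi x).
Proof.
move=> [sp [a [b [a0 bl ab]]]] [sp' [a' [b' [a'0 b'l ab']]]]; split.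
  apply: smooth_algP; apply: smooth_alg_add; first exact: smooth_id_alg.
  apply: smooth_alg_mul; first exact: smooth_alg_cst.
  exact: smooth_id_alg.
exists (Num.min a a'), (Num.max b b').
rewrite lt_min a0 a'0 gt_max bl b'l; split => // x.
move=> xM; rewrite ab ?ab' ?mulr0 ?addr0//; apply: contra xM => /andP[? ?].
  by rewrite ge_min le_max; apply/andP; split; apply/orP; right.
by rewrite ge_min le_max; apply/andP; split; apply/orP; left.
Qed.

End Smooth.


(** * Integrals over an edge *)

Lemma measurable_edge_int (R : realType) (l : R) : measurable (edge_int l).
Proof. exact: measurable_itv. Qed.

(** The Borel sets of R as the domain of the Lebesgue measure, whose display
    differs from that of the canonical structure on R. *)
Lemma measurable_edge_intR (R : realType) (l : R) :
  measurable (edge_int l : set (measurableTypeR R)).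
Proof. exact: measurable_itv. Qed.

#[local] Hint Resolve measurable_edge_int measurable_edge_intR : core.

Section RealIntegral.
Variable R : realType.
Local Notation mu := (@lebesgue_measure R).
Implicit Types (l : R) (u v : R -> R).

Definition L1 l u := mu.-integrable (edge_int l) (EFin \o u).

Lemma edge_int_lt_infty l : (mu (edge_int l) < +oo)%E.
Proof. by rewrite lebesgue_measure_itv /=; case: ifP => // _; rewrite ltry. Qed.

Lemma L1_measurable l u : L1 l u -> measurable_fun (edge_int l) u.
Proof. by move=> /measurable_int/measurable_EFinP. Qed.

Lemma sub_edge_int (x l : R) : x <= l -> edge_int x `<=` edge_int l.
Proof. by move=> xl; apply: subset_itvl; rewrite bnd_simp. Qed.

Lemma L1S l x u : x <= l -> L1 l u -> L1 x u.
Proof.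
move=> xl; apply: integrableS; [exact: measurable_edge_int|exact: measurable_edge_int|].
by apply: subset_itvl; rewrite bnd_simp.
Qed.

Lemma L1_restrict l u : L1 l u ->
  mu.-integrable setT (EFin \o (u \_ (edge_int l))).
Proof.
move=> ul; rewrite -restrict_EFin.
by have [+ _] := @integrable_mkcond _ _ _ mu (edge_int l) (EFin \o u)
  (measurable_edge_int l); exact.
Qed.

Lemma L1_cc l u : 0 < l -> L1 l u -> mu.-integrable `[0, l] (EFin \o u).
Proof.
move=> l0 ul; apply/integrableP; split.
  apply/emeasurable_fun_itv_obnd_cbndP/emeasurable_fun_itv_bndo_bndcP.
  exact: measurable_int ul.
rewrite integral_itv_bndoo; last first.
  by apply: measurableT_comp => //; exact: measurable_int ul.
by have /integrableP[] := ul.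
Qed.

Lemma edge_intE l u x : 0 <= x <= l -> L1 l u ->
  Rintegral mu (edge_int x) u = parameterized_integral mu 0 x u.
Proof.
move=> /andP[x0 xl] /(L1S xl) ux; rewrite /parameterized_integral /Rintegral.
congr fine; rewrite [RHS]integral_itv_bndoo//; exact: measurable_int ux.
Qed.

Lemma continuous_Rintegral l u : 0 < l -> L1 l u ->
  {within `[0, l], continuous (fun x => Rintegral mu (edge_int x) u)}.
Proof.
move=> l0 ul.
have := parameterized_integral_continuous (ltW l0) (L1_cc l0 ul).
apply: subspace_eq_continuous => x; rewrite inE/= in_itv/= => xl.
by apply: esym; apply: edge_intE xl ul.
Qed.

Lemma measurable_continuous_edge l u : {within `[0, l], continuous u} ->
  measurable_fun (edge_int l) u.
Proof.
move=> cu; apply: (@measurable_funS _ _ _ _ `[0, l]) => //.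
  exact: subset_itv_oo_cc.
exact: subspace_continuous_measurable_fun.
Qed.

Lemma bounded_continuous_edge l u : {within `[0, l], continuous u} ->
  [bounded u x | x in edge_int l].
Proof.
move=> cu; have /compact_bounded[M [Mr uM]] :=
  continuous_compact cu (@segment_compact _ 0 l).
exists M; split => // y My x xl; apply: uM My _ _.
by exists x => //; exact: subset_itv_oo_cc.
Qed.

Lemma L1M_continuous l u v : L1 l u -> {within `[0, l], continuous v} ->
  L1 l (fun x => u x * v x).
Proof.
move=> ul cv.
rewrite /L1 (_ : EFin \o _ = ((EFin \o u) \* (EFin \o v))%E)//.
apply: integrableMl => //; first exact: (measurable_continuous_edge cv).
exact: (bounded_continuous_edge cv).
Qed.

Lemma L1_continuous l v : {within `[0, l], continuous v} -> L1 l v.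
Proof.
move=> cv; apply: measurable_bounded_integrable => //.
- exact: edge_int_lt_infty.
- exact: measurable_continuous_edge.
- exact: bounded_continuous_edge.
Qed.

Lemma restrict_integral (A : set R) u c :
  measurable (A : set (measurableTypeR R)) -> mu.-integrable A (EFin \o u) ->
  (\int[mu]_x (c%:E * ((u \_ A) x)%:E))%E = (c * Rintegral mu A u)%:E.
Proof.
move=> mA uA; rewrite EFinM /Rintegral fineK; last exact: integrable_fin_num.
rewrite [in RHS]integral_mkcond integralZl//; last first.
  by have [+ _] := @integrable_mkcond _ _ _ mu A (EFin \o u) mA; rewrite restrict_EFin; exact.
by congr (_ * _)%E; apply: eq_integral => x _; rewrite !patchE; case: ifP.
Qed.

(** Both sides are the integral of [u x * v y] over the triangle [y < x] of the
    square, in the two orders of integration. *)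
Lemma Rintegral_triangles l u v : 0 < l -> L1 l u -> L1 l v ->
  Rintegral mu (edge_int l) (fun x => u x * Rintegral mu (edge_int x) v) =
  Rintegral mu (edge_int l)
    (fun y => v y * (Rintegral mu (edge_int l) u - Rintegral mu (edge_int y) u)).
Proof.
move=> l0 ul vl.
set D := edge_int l; set u' := u \_ D; set v' := v \_ D.
have iu : mu.-integrable setT (EFin \o u') := L1_restrict ul.
have iv : mu.-integrable setT (EFin \o v') := L1_restrict vl.
have mu' : measurable_fun setT u'.
  by move/measurable_int: iu => /measurable_EFinP.
have mv' : measurable_fun setT v'.
  by move/measurable_int: iv => /measurable_EFinP.
pose f (z : measurableTypeR R * measurableTypeR R) : \bar R := (if z.2 < z.1 then u' z.1 * v' z.2 else 0)%:E.
have mf : measurable_fun setT f.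
  apply/measurable_EFinP; apply: measurable_fun_ifT => //.
    exact: measurable_fun_ltr.
  by apply: measurable_funM; apply: measurableT_comp.
have if_ : (mu \x mu)%E.-integrable setT f.
  apply/(@integrable12ltyP _ _ _ _ _ mu mu f mf).
  have inner x : (\int[mu]_y `|f (x, y)| <=
      `|u' x|%:E * \int[mu]_y `|(v' y)%:E|)%E.
    rewrite -ge0_integralZl//; last by do 2 apply: measurableT_comp => //.
    apply: ge0_le_integral => //.
    - by apply: measurableT_comp => //; exact: measurable_fun_pair2.
    - by apply: measurable_funeM; do 2 apply: measurableT_comp => //.
    - move=> y _; rewrite /f /=; case: ifP => _.
        by rewrite normrM lee_fin.
      by rewrite normr0 lee_fin mulr_ge0.
  apply: (@le_lt_trans _ _ (\int[mu]_x
      (`|u' x|%:E * \int[mu]_y `|(v' y)%:E|))%E).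
    apply: ge0_le_integral => //.
    - by move=> x _; exact: integral_ge0.
    - apply: (@measurable_fun_fubini_tonelli_F _ _ _ _ _ mu (fun z => `|f z|%E)) => //.
      exact: measurableT_comp.
    - by apply: emeasurable_funM => //; do 2 apply: measurableT_comp => //.
  have [_ Iu] := integrableP _ _ _ iu; have [_ Iv] := integrableP _ _ _ iv.
  rewrite ge0_integralZr//.
  - by rewrite lte_mul_pinfty ?integral_ge0 ?ge0_fin_numE ?integral_ge0.
  - by do 2 apply: measurableT_comp => //.
  - by apply: integral_ge0.
have := Fubini if_.
have inner1 x : (\int[mu]_y f (x, y))%E =
    ((fun x => u x * Rintegral mu (edge_int x) v) \_ D x)%:E.
  rewrite patchE; case: ifPn => [/set_mem|] xD; last first.
    rewrite integral0_eq// => y _; rewrite /f /= /u' patchE (negbTE xD) mul0r.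
    by case: ifP.
  have xl : x <= l by move: xD; rewrite /D /edge_int /= in_itv /= => /andP[_ /ltW].
  rewrite -(restrict_integral _ _ (L1S xl vl))//; apply: eq_integral => y _.
  rewrite /f /= /u' /v' !patchE (mem_set xD) -EFinM; congr EFin.
  have xlt : x < l by move: xD; rewrite /D /edge_int /= in_itv /= => /andP[].
  case: ifPn => yx; last first.
    rewrite memNset ?mulr0// /edge_int /= in_itv/= (negbTE yx) andbF//.
  suff -> : (y \in D) = (y \in edge_int x) by [].
  by apply/idP/idP; rewrite !inE /D /edge_int/= !in_itv/= yx => /andP[-> //=];
    rewrite (lt_trans yx).
have inner2 y : (\int[mu]_x f (x, y))%E =
    ((fun y => v y * (Rintegral mu D u - Rintegral mu (edge_int y) u)) \_ D y)%:E.
  rewrite patchE; case: ifPn => [/set_mem|] yD; last first.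
    rewrite integral0_eq// => x _; rewrite /f /= /v' patchE (negbTE yD) mulr0.
    by case: ifP.
  have /andP[y0 yl] : (0 < y) && (y < l).
    by move: yD; rewrite /D /edge_int /= in_itv.
  rewrite (Rintegral_itv_bndo_bndc (a := BRight 0) (r := y)); last first.
    exact: L1S (ltW yl) ul.
  rewrite Rintegral_itvB ?bnd_simp ?(ltW yl) ?(ltW y0)//.
  have uyl : mu.-integrable `]y, l[ (EFin \o u).
    apply: integrableS ul => //.
    by apply: subset_itvr; rewrite bnd_simp ltW.
  rewrite -(restrict_integral _ _ uyl)//; apply: eq_integral => x _.
  rewrite /f /= /u' /v' !patchE (mem_set yD) -EFinM; congr EFin.
  case: ifPn => yx; last first.
    by rewrite memNset ?mulr0// /= in_itv/= (negbTE yx).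
  suff -> : (x \in D) = (x \in [set` `]y, l[]%R); first by rewrite mulrC.
  apply/idP/idP => /set_mem; rewrite /D /edge_int /= in_itv /= => /andP[_ xl];
    apply/mem_set; rewrite /edge_int /= in_itv /= xl andbT //.
  exact: lt_trans y0 yx.
under eq_integral do rewrite inner1.
under [in RHS]eq_integral do rewrite inner2.
by move=> E; rewrite Rintegral_mkcond [RHS]Rintegral_mkcond /Rintegral E.
Qed.

End RealIntegral.


(** * Complex integrals and primitives *)

Section ComplexIntegral.
Variable R : realType.
Local Notation mu := (@lebesgue_measure R).
Local Notation Re := (@complex.Re R).
Local Notation Im := (@complex.Im R).
Implicit Types (l : R) (u v : R -> R) (f g : R -> R[i]) (c : R[i]).

Lemma cReD (z w : R[i]) : Re (z + w) = Re z + Re w. Proof. by case: z w => [? ?] []. Qed.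
Lemma cImD (z w : R[i]) : Im (z + w) = Im z + Im w. Proof. by case: z w => [? ?] []. Qed.
Lemma cReN (z : R[i]) : Re (- z) = - Re z. Proof. by case: z. Qed.
Lemma cImN (z : R[i]) : Im (- z) = - Im z. Proof. by case: z. Qed.
Lemma cReM (z w : R[i]) : Re (z * w) = Re z * Re w - Im z * Im w.
Proof. by case: z w => [? ?] []. Qed.
Lemma cImM (z w : R[i]) : Im (z * w) = Re z * Im w + Im z * Re w.
Proof. by case: z w => [? ?] []. Qed.
Lemma cRe_conj (z : R[i]) : Re (conjc z) = Re z. Proof. by case: z. Qed.
Lemma cIm_conj (z : R[i]) : Im (conjc z) = - Im z. Proof. by case: z. Qed.
Lemma complex_eqP (z w : R[i]) : Re z = Re w -> Im z = Im w -> z = w.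
Proof. by case: z w => [? ?] [? ?] /= -> ->. Qed.

Definition ReImE := (cReD, cImD, cReN, cImN, cReM, cImM, cRe_conj, cIm_conj).

Lemma L1D l u v : L1 l u -> L1 l v -> L1 l (fun x => u x + v x).
Proof.
move=> ul vl; rewrite /L1 (_ : EFin \o _ = ((EFin \o u) \+ (EFin \o v))%E)//.
exact: integrableD.
Qed.

Lemma L1Z l a u : L1 l u -> L1 l (fun x => a * u x).
Proof.
move=> ul; rewrite /L1 (_ : EFin \o _ = (fun x => a%:E * (EFin \o u) x)%E)//.
exact: integrableZl.
Qed.

Lemma L1N l u : L1 l u -> L1 l (fun x => - u x).
Proof.
move=> ul; rewrite /L1 (_ : EFin \o _ = -%E \o (EFin \o u))//.
exact: integrableN.
Qed.

Lemma L1B l u v : L1 l u -> L1 l v -> L1 l (fun x => u x - v x).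
Proof. by move=> ul vl; apply: L1D => //; exact: L1N. Qed.

Lemma L1_eq l u v : (forall x, edge_int l x -> u x = v x) -> L1 l u -> L1 l v.
Proof.
move=> uv; apply: eq_integrable => // x /set_mem xl /=; by rewrite uv.
Qed.

Lemma L1_cst l a : L1 l (fun=> a).
Proof.
by apply: L1_continuous => x; exact: cst_continuous.
Qed.

Lemma RintegralN l u : L1 l u ->
  Rintegral mu (edge_int l) (fun x => - u x) = - Rintegral mu (edge_int l) u.
Proof.
move=> ul; rewrite -mulN1r -RintegralZl//.
by apply: eq_Rintegral => x _; rewrite mulN1r.
Qed.

Lemma ae_Rintegral l u v : measurable_fun (edge_int l) u ->
  measurable_fun (edge_int l) v -> ae_eq mu (edge_int l) u v ->
  Rintegral mu (edge_int l) u = Rintegral mu (edge_int l) v.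
Proof.
move=> ul vl uv; congr fine; apply: ae_eq_integral => //.
- exact/measurable_EFinP.
- exact/measurable_EFinP.
- by apply: filterS uv => x /= + xl => ->.
Qed.

Lemma L1_ae l u v : measurable_fun (edge_int l) v ->
  ae_eq mu (edge_int l) u v -> L1 l u -> L1 l v.
Proof.
move=> vl uv ul; apply/integrableP; split; first exact/measurable_EFinP.
have /integrableP[mul] := ul; congr (_ < _)%E.
apply: ae_eq_integral => //.
- exact: measurableT_comp.
- by apply: measurableT_comp => //; exact/measurable_EFinP.
- by apply: filterS uv => x /= + xl => ->.
Qed.

Lemma RintD l u v : L1 l u -> L1 l v ->
  Rintegral mu (edge_int l) (fun x => u x + v x) =
  Rintegral mu (edge_int l) u + Rintegral mu (edge_int l) v.
Proof. by move=> ul vl; rewrite RintegralD. Qed.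

Lemma RintB l u v : L1 l u -> L1 l v ->
  Rintegral mu (edge_int l) (fun x => u x - v x) =
  Rintegral mu (edge_int l) u - Rintegral mu (edge_int l) v.
Proof. by move=> ul vl; rewrite RintegralB. Qed.

Lemma RintZ l a u : L1 l u ->
  Rintegral mu (edge_int l) (fun x => a * u x) = a * Rintegral mu (edge_int l) u.
Proof. by move=> ul; rewrite RintegralZl. Qed.

Definition sq_int l u := measurable_fun (edge_int l) u /\ L1 l (fun x => u x ^+ 2).

Lemma sq_intM l u v : sq_int l u -> sq_int l v -> L1 l (fun x => u x * v x).
Proof.
move=> [mu_ u2] [mv v2]; apply: le_integrable (L1D u2 v2) => //.
  by apply/measurable_EFinP; exact: measurable_funM.
move=> x _; rewrite lee_fin normrM (ger0_norm (addr_ge0 (sqr_ge0 _) (sqr_ge0 _))).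
rewrite -(real_normK (num_real (u x))) -(real_normK (num_real (v x))).
have := sqr_ge0 (`|u x| - `|v x|); have := sqr_ge0 (`|u x| + `|v x|); lra.
Qed.

Lemma sq_int_eq l u v : (forall x, edge_int l x -> u x = v x) ->
  sq_int l u -> sq_int l v.
Proof.
move=> uv [mu_ u2]; split.
  by apply: eq_measurable_fun mu_ => x /set_mem; exact: uv.
by apply: L1_eq u2 => x xl; rewrite uv.
Qed.

Lemma sq_intMb l u v : measurable_fun (edge_int l) v ->
  (exists M, forall x, edge_int l x -> `|v x| <= M) ->
  sq_int l u -> sq_int l (fun x => v x * u x).
Proof.
move=> mv [M vM] [mu_ u2]; split; first exact: measurable_funM.
apply: le_integrable (L1Z (M ^+ 2) u2) => //.
  by apply/measurable_EFinP; apply: measurable_funX; exact: measurable_funM.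
move=> x xl; have M0 : 0 <= M by exact: le_trans (vM _ xl).
have vM2 : v x ^+ 2 <= M ^+ 2.
  by rewrite -(real_normK (num_real (v x))) ler_sqr ?nnegrE ?vM.
rewrite lee_fin /= ger0_norm ?sqr_ge0// ger0_norm; last first.
  by apply: mulr_ge0; exact: sqr_ge0.
by rewrite exprMn ler_wpM2r ?sqr_ge0.
Qed.

Lemma sq_intD l u v : sq_int l u -> sq_int l v -> sq_int l (fun x => u x + v x).
Proof.
move=> iu iv; split; first by apply: measurable_funD; [case: iu|case: iv].
have H := L1D (L1D iu.2 iv.2) (L1Z 2 (sq_intM iu iv)).
by apply: L1_eq H => x _; ring.
Qed.

Lemma continuous_sq_int l u : {within `[0, l], continuous u} -> sq_int l u.
Proof.
move=> cu; split; first exact: measurable_continuous_edge.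
by apply: L1_eq (L1M_continuous (L1_continuous cu) cu) => x _; rewrite expr2.
Qed.

Lemma sq_int_cst l a : sq_int l (fun=> a).
Proof. by apply: continuous_sq_int => x; exact: cst_continuous. Qed.

Lemma sq_intZ l a u : sq_int l u -> sq_int l (fun x => a * u x).
Proof.
by apply: sq_intMb; [exact: measurable_cst|exists `|a|].
Qed.

Lemma sq_int_L1 l u : sq_int l u -> L1 l u.
Proof.
move=> iu; apply: L1_eq (sq_intM iu (sq_int_cst l 1)) => x _; exact: mulr1.
Qed.

Definition cL1 l f := L1 l (Re \o f) /\ L1 l (Im \o f).

Lemma L2P l f : L2 l f <-> sq_int l (Re \o f) /\ sq_int l (Im \o f).
Proof.
split=> [[mr mi f2]|[[mr r2] [mi i2]]].
  suff H u : measurable_fun (edge_int l) u ->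
      (forall x, u x ^+ 2 <= Re (f x) ^+ 2 + Im (f x) ^+ 2) -> sq_int l u.
    split; apply: H => //= x; first by rewrite lerDl sqr_ge0.
    by rewrite lerDr sqr_ge0.
  move=> mu_ uf; split=> //; apply/integrableP; split.
    by apply/measurable_EFinP; exact: measurable_funX.
  apply: le_lt_trans f2; apply: ge0_le_integral => //.
  - by do 2 apply: measurableT_comp => //; exact: measurable_funX.
  - apply/measurable_EFinP; apply: measurable_funD; exact: measurable_funX.
  - by move=> x _; rewrite lee_fin ger0_norm ?sqr_ge0.
split => //; have /integrableP[_] := L1D r2 i2; apply: le_lt_trans.
apply: ge0_le_integral => //.
- by move=> x _; rewrite lee_fin addr_ge0 ?sqr_ge0.
- apply/measurable_EFinP; apply: measurable_funD; exact: measurable_funX.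
- do 2 apply: measurableT_comp => //; apply: measurable_funD; exact: measurable_funX.
- by move=> x _ /=; rewrite lee_fin ler_norm.
Qed.

Lemma L2_cL1 l f : L2 l f -> cL1 l f.
Proof. by move=> /L2P[fr fi]; split; exact: sq_int_L1. Qed.

Lemma L2D l f g : L2 l f -> L2 l g -> L2 l (fun x => f x + g x).
Proof.
move=> /L2P[fr fi] /L2P[gr gi]; apply/L2P; split.
  by apply: sq_int_eq (sq_intD fr gr) => x _ /=; rewrite cReD.
by apply: sq_int_eq (sq_intD fi gi) => x _ /=; rewrite cImD.
Qed.

Lemma L2Z l c f : L2 l f -> L2 l (fun x => c * f x).
Proof.
move=> /L2P[fr fi]; apply/L2P; split.
  apply: sq_int_eq (sq_intD (sq_intZ (Re c) fr) (sq_intZ (- Im c) fi)) => x _ /=.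
  by rewrite cReM mulNr.
apply: sq_int_eq (sq_intD (sq_intZ (Re c) fi) (sq_intZ (Im c) fr)) => x _ /=.
by rewrite cImM.
Qed.

Lemma L2_conj l f : L2 l f -> L2 l (fun x => conjc (f x)).
Proof.
move=> /L2P[fr fi]; apply/L2P; split.
  by apply: sq_int_eq fr => x _ /=; rewrite cRe_conj.
by apply: sq_int_eq (sq_intZ (-1) fi) => x _ /=; rewrite cIm_conj mulN1r.
Qed.

Lemma L2Mb l f v : measurable_fun (edge_int l) v ->
  (exists M, forall x, edge_int l x -> `|v x| <= M) ->
  L2 l f -> L2 l (fun x => (v x)%:C%C * f x).
Proof.
move=> mv bv /L2P[fr fi]; apply/L2P; split.
  by apply: sq_int_eq (sq_intMb mv bv fr) => x _; rewrite /= cReM /= mul0r subr0.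
by apply: sq_int_eq (sq_intMb mv bv fi) => x _; rewrite /= cImM /= mul0r addr0.
Qed.

Lemma cL1M l f g : L2 l f -> L2 l g -> cL1 l (fun x => f x * g x).
Proof.
move=> /L2P[fr fi] /L2P[gr gi]; split.
  by apply: L1_eq (L1B (sq_intM fr gr) (sq_intM fi gi)) => x _ /=; rewrite cReM.
by apply: L1_eq (L1D (sq_intM fr gi) (sq_intM fi gr)) => x _ /=; rewrite cImM.
Qed.

Lemma cL1_eq l f g : (forall x, edge_int l x -> f x = g x) -> cL1 l f -> cL1 l g.
Proof.
by move=> fg [fr fi]; split; [apply: L1_eq fr|apply: L1_eq fi] => x xl /=; rewrite fg.
Qed.

Lemma cL1D l f g : cL1 l f -> cL1 l g -> cL1 l (fun x => f x + g x).
Proof.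
move=> [fr fi] [gr gi]; split.
  by apply: L1_eq (L1D fr gr) => x _ /=; rewrite cReD.
by apply: L1_eq (L1D fi gi) => x _ /=; rewrite cImD.
Qed.

Lemma cL1Z l c f : cL1 l f -> cL1 l (fun x => c * f x).
Proof.
move=> [fr fi]; split.
  by apply: L1_eq (L1B (L1Z (Re c) fr) (L1Z (Im c) fi)) => x _ /=; rewrite cReM.
by apply: L1_eq (L1D (L1Z (Re c) fi) (L1Z (Im c) fr)) => x _ /=; rewrite cImM.
Qed.

Lemma cL1_conj l f : cL1 l f -> cL1 l (fun x => conjc (f x)).
Proof.
move=> [fr fi]; split; first by apply: L1_eq fr => x _ /=; rewrite cRe_conj.
by apply: L1_eq (L1N fi) => x _ /=; rewrite cIm_conj.
Qed.

Lemma cL1S l x f : x <= l -> cL1 l f -> cL1 x f.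
Proof. by move=> xl [? ?]; split; exact: L1S xl _. Qed.

Lemma eq_cintegral l f g : (forall x, edge_int l x -> f x = g x) ->
  cintegral l f = cintegral l g.
Proof.
by move=> fg; congr Complex; apply: eq_Rintegral => x /set_mem xl /=; rewrite fg.
Qed.

Lemma cintegralD l f g : cL1 l f -> cL1 l g ->
  cintegral l (fun x => f x + g x) = cintegral l f + cintegral l g.
Proof.
move=> [fr fi] [gr gi]; rewrite /cintegral; apply: complex_eqP => /=.
  by rewrite -RintD//; apply: eq_Rintegral => x _ /=; rewrite cReD.
by rewrite -RintD//; apply: eq_Rintegral => x _ /=; rewrite cImD.
Qed.

Lemma cintegralZ l c f : cL1 l f ->
  cintegral l (fun x => c * f x) = c * cintegral l f.
Proof.
move=> [fr fi]; apply: complex_eqP; rewrite ?cReM ?cImM /=.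
  rewrite -!RintZ// -RintB//; [|exact: L1Z..].
  by apply: eq_Rintegral => x _ /=; rewrite cReM.
rewrite -!RintZ// -RintD//; [|exact: L1Z..].
by apply: eq_Rintegral => x _ /=; rewrite cImM.
Qed.

Lemma cintegralN l f : cL1 l f -> cintegral l (fun x => - f x) = - cintegral l f.
Proof.
move=> fl; rewrite -mulN1r -cintegralZ//.
by apply: eq_cintegral => x _; rewrite mulN1r.
Qed.

Lemma cL1N l f : cL1 l f -> cL1 l (fun x => - f x).
Proof. by move=> /(cL1Z (-1)); apply: cL1_eq => x _; rewrite mulN1r. Qed.

Lemma L2N l f : L2 l f -> L2 l (fun x => - f x).
Proof.
move=> /(L2Z (-1)) /L2P[a b]; apply/L2P; split.
  by apply: sq_int_eq a => x _ /=; rewrite mulN1r.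
by apply: sq_int_eq b => x _ /=; rewrite mulN1r.
Qed.

Lemma L2B l f g : L2 l f -> L2 l g -> L2 l (fun x => f x - g x).
Proof. by move=> fl gl; apply: L2D => //; exact: L2N. Qed.

Lemma cintegralB l f g : cL1 l f -> cL1 l g ->
  cintegral l (fun x => f x - g x) = cintegral l f - cintegral l g.
Proof. by move=> fl gl; rewrite cintegralD ?cintegralN//; exact: cL1N. Qed.

Lemma cintegral_conj l f : cL1 l f ->
  cintegral l (fun x => conjc (f x)) = conjc (cintegral l f).
Proof.
move=> [fr fi]; apply: complex_eqP; rewrite ?cRe_conj ?cIm_conj /=.
  by apply: eq_Rintegral => x _; rewrite cRe_conj.
by rewrite -RintegralN//; apply: eq_Rintegral => x _; rewrite cIm_conj.
Qed.

Lemma cintegral_eq0 l f : (forall x, edge_int l x -> f x = 0) -> cintegral l f = 0.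
Proof.
move=> f0; rewrite (@eq_cintegral l f (fun=> 0 * 0)) => [|x xl]; last first.
  by rewrite f0 ?mulr0.
by rewrite cintegralZ ?mul0r//; split; exact: L1_cst.
Qed.

Lemma aeq_Re l f g : aeq l f g -> ae_eq mu (edge_int l) (Re \o f) (Re \o g).
Proof. by apply: filterS => x /= + xl => ->. Qed.

Lemma aeq_Im l f g : aeq l f g -> ae_eq mu (edge_int l) (Im \o f) (Im \o g).
Proof. by apply: filterS => x /= + xl => ->. Qed.

Lemma aeq_cintegral l f g : aeq l f g -> cL1 l f -> cL1 l g ->
  cintegral l f = cintegral l g.
Proof.
move=> fg [fr fi] [gr gi]; apply: complex_eqP => /=.
  by apply: ae_Rintegral (aeq_Re fg); exact: L1_measurable.
by apply: ae_Rintegral (aeq_Im fg); exact: L1_measurable.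
Qed.

Lemma cintegral0r f : cintegral 0 f = 0.
Proof.
by apply: cintegral_eq0 => x; rewrite /edge_int /= in_itv /= lt_asym.
Qed.

Lemma cL1M_continuous l f F : cL1 l f ->
  {within `[0, l], continuous (Re \o F)} ->
  {within `[0, l], continuous (Im \o F)} -> cL1 l (fun x => f x * F x).
Proof.
move=> [fr fi] Fr Fi; split.
  apply: L1_eq (L1B (L1M_continuous fr Fr) (L1M_continuous fi Fi)) => x _ /=.
  by rewrite cReM.
apply: L1_eq (L1D (L1M_continuous fr Fi) (L1M_continuous fi Fr)) => x _ /=.
by rewrite cImM.
Qed.

Lemma cintegral_triangles l f g : 0 < l -> cL1 l f -> cL1 l g ->
  cintegral l (fun x => f x * cintegral x g) =
  cintegral l (fun x => g x * (cintegral l f - cintegral x f)).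
Proof.
move=> l0 [fr fi] [gr gi].
have T := Rintegral_triangles l0.
have I u v : L1 l u -> L1 l v -> L1 l (fun x => u x * Rintegral mu (edge_int x) v).
  by move=> ul vl; apply: L1M_continuous => //; exact: continuous_Rintegral.
have J u v : L1 l u -> L1 l v -> L1 l (fun x => u x *
    (Rintegral mu (edge_int l) v - Rintegral mu (edge_int x) v)).
  move=> ul vl; apply: L1_eq (L1B (L1Z (Rintegral mu (edge_int l) v) ul) (I _ _ ul vl)).
  by move=> x _; rewrite mulrBr mulrC.
apply: complex_eqP => /=.
  transitivity (Rintegral mu (edge_int l) (fun x =>
     Re (f x) * Rintegral mu (edge_int x) (Re \o g) -
     Im (f x) * Rintegral mu (edge_int x) (Im \o g))).
    by apply: eq_Rintegral => x _; rewrite cReM.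
  rewrite RintB//; [|exact: I..].
  rewrite T// [X in _ - X]T// -RintB//; [|exact: J..].
  by apply: eq_Rintegral => x _; rewrite cReM !ReImE.
transitivity (Rintegral mu (edge_int l) (fun x =>
   Re (f x) * Rintegral mu (edge_int x) (Im \o g) +
   Im (f x) * Rintegral mu (edge_int x) (Re \o g))).
  by apply: eq_Rintegral => x _; rewrite cImM.
rewrite RintD//; [|exact: I..].
rewrite T// [X in _ + X]T// -RintD//; [|exact: J..].
by apply: eq_Rintegral => x _; rewrite cImM !ReImE /= addrC.
Qed.

(** [F] is absolutely continuous on [0, l] with derivative [f]. *)
Definition primitive l (F f : R -> R[i]) :=
  cL1 l f /\ forall x, 0 <= x <= l -> F x = F 0 + cintegral x f.

Lemma primitive_continuous l F f : 0 < l -> primitive l F f ->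
  {within `[0, l], continuous (Re \o F)} /\
  {within `[0, l], continuous (Im \o F)}.
Proof.
move=> l0 [[fr fi] FE]; split.
  apply: (@subspace_eq_continuous _ _ _
    (fun x => Re (F 0) + Rintegral mu (edge_int x) (Re \o f))) => [x|].
    by rewrite inE /= in_itv /= => xl; have := congr1 Re (FE x xl); rewrite cReD => /esym.
  move=> x; apply: cvgD; [exact: cvg_cst|exact: continuous_Rintegral].
apply: (@subspace_eq_continuous _ _ _
  (fun x => Im (F 0) + Rintegral mu (edge_int x) (Im \o f))) => [x|].
  by rewrite inE /= in_itv /= => xl; have := congr1 Im (FE x xl); rewrite cImD => /esym.
move=> x; apply: cvgD; [exact: cvg_cst|exact: continuous_Rintegral].
Qed.

Lemma primitive_cL1M l F f g : 0 < l -> primitive l F f -> cL1 l g ->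
  cL1 l (fun x => g x * F x).
Proof.
by move=> l0 pF gl; have [Fr Fi] := primitive_continuous l0 pF; exact: cL1M_continuous.
Qed.

Lemma primitive_L2 l F f : 0 < l -> primitive l F f -> L2 l F.
Proof.
move=> l0 /(primitive_continuous l0)[Fr Fi].
by apply/L2P; split; exact: continuous_sq_int.
Qed.

Lemma primitive_cintegral l f : cL1 l f -> primitive l (fun x => cintegral x f) f.
Proof. by move=> fl; split => // x _; rewrite cintegral0r add0r. Qed.

(** Once [F] and [G] are written as constants plus integrals, the only product
    of integrals is the one that Fubini's theorem evaluates. *)
Lemma primitive_by_parts l F f G g : 0 < l -> primitive l F f ->
  primitive l G g ->
  cintegral l (fun x => f x * G x + F x * g x) = F l * G l - F 0 * G 0.
Proof.
move=> l0 pF pG; have [fl FE] := pF; have [gl GE] := pG.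
have pU := primitive_cintegral fl; have pV := primitive_cintegral gl.
have -> : cintegral l (fun x => f x * G x + F x * g x) = cintegral l (fun x =>
   (G 0 * f x + F 0 * g x) + (f x * cintegral x g + g x * cintegral x f)).
  apply: eq_cintegral => x; rewrite /edge_int /= in_itv /= => /andP[/ltW x0 /ltW xl].
  rewrite FE ?x0// GE ?x0//; ring.
have ifV := primitive_cL1M l0 pV fl; have igU := primitive_cL1M l0 pU gl.
have iG := cL1Z (G 0) fl; have iF := cL1Z (F 0) gl.
rewrite cintegralD; [|exact: cL1D..].
rewrite cintegralD// (@cintegralD l (fun x => f x * _))// cintegral_triangles//.
have -> : cintegral l (fun x => g x * (cintegral l f - cintegral x f)) =
   cintegral l f * cintegral l g - cintegral l (fun x => g x * cintegral x f).
  rewrite -cintegralZ// -cintegralB//; last exact: cL1Z.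
  by apply: eq_cintegral => x _; rewrite mulrBr [cintegral l f * _]mulrC.
rewrite !cintegralZ// (FE l) ?lexx ?ltW// (GE l) ?lexx ?ltW//; ring.
Qed.

Lemma primitiveD l F f G g : primitive l F f -> primitive l G g ->
  primitive l (fun x => F x + G x) (fun x => f x + g x).
Proof.
move=> [fl FE] [gl GE]; split=> [|x /[dup] xl /andP[_ xl']]; first exact: cL1D.
rewrite FE// GE// cintegralD; [ring|exact: cL1S fl|exact: cL1S gl].
Qed.

Lemma primitive_conj l F f : primitive l F f ->
  primitive l (fun x => conjc (F x)) (fun x => conjc (f x)).
Proof.
move=> [fl FE]; split=> [|x /[dup] xl /andP[_ xl']]; first exact: cL1_conj.
by rewrite FE// cintegral_conj ?rmorphD//; exact: cL1S fl.
Qed.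

Lemma primitive_cst l c : primitive l (fun=> c) (fun=> 0).
Proof.
split=> [|x _]; first by split; exact: L1_cst.
by rewrite cintegral_eq0 ?addr0.
Qed.

Lemma primitive_derive l (u v : R -> R) : 0 < l ->
  (forall x, is_derive x (1:R) u (v x)) -> continuous v ->
  primitive l (fun x => (u x)%:C%C) (fun x => (v x)%:C%C).
Proof.
move=> l0 uv cv.
have vl : L1 l v by apply: L1_continuous; exact: continuous_subspaceT.
split=> [|x /andP[]]; first by split => //; exact: L1_cst.
rewrite le_eqVlt => /predU1P[<- _|x0 xl]; first by rewrite cintegral0r addr0.
apply: complex_eqP => /=; rewrite ?ReImE /=; last first.
  by rewrite /Rintegral integral0 /= addr0.
rewrite (@edge_intE _ l) ?(ltW x0)// /parameterized_integral /Rintegral.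
rewrite (@continuous_FTC2 _ v u)//=; last 3 first.
- exact: continuous_subspaceT.
- have cu y : {for y, continuous u}.
    by apply/differentiable_continuous/derivable1_diffP; exact: ex_derive.
  split=> [y _||]; first exact: ex_derive.
    by apply: cvg_at_right_filter; exact: cu.
  by apply: cvg_at_left_filter; exact: cu.
- by move=> y _; rewrite derive1E; exact: derive_val.
by rewrite addrCA subrr addr0.
Qed.

End ComplexIntegral.


(** * The du Bois-Reymond lemma *)

Section DuBoisReymond.
Variable R : realType.
Local Notation mu := (@lebesgue_measure R).
Local Notation Re := (@complex.Re R).
Local Notation Im := (@complex.Im R).
Implicit Types (l : R) (u v phi : R -> R) (f g : R -> R[i]) (c : R[i]).

Lemma test_fun_continuous l phi : test_fun l phi -> continuous phi.
Proof. by move=> [sp _]; exact: smooth_continuous. Qed.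

Lemma test_fun_within l phi : test_fun l phi -> {within `[0, l], continuous phi}.
Proof. by move=> /test_fun_continuous cp; exact: continuous_subspaceT. Qed.

Lemma test_fun0 l phi : test_fun l phi -> phi 0 = 0.
Proof.
by move=> [_ [a [b [a0 _ ab]]]]; rewrite ab// negb_and -ltNge a0.
Qed.

Lemma test_funl l phi : test_fun l phi -> phi l = 0.
Proof.
by move=> [_ [a [b [_ bl ab]]]]; rewrite ab// negb_and -!ltNge bl orbT.
Qed.

(** Dominated convergence along the plateau functions of ]0, d[. *)
Lemma Rintegral_edge_eq0 l u : 0 < l -> L1 l u ->
  (forall phi, test_fun l phi -> Rintegral mu (edge_int l) (fun x => u x * phi x) = 0) ->
  forall d, 0 <= d <= l -> Rintegral mu (edge_int d) u = 0.
Proof.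
move=> l0 ul utest d /andP[d0 dl].
have mu_ := L1_measurable ul.
pose f_ n x := (u x * plateau 0 d n x)%:E.
have cb n : continuous (plateau 0 d n) by apply: smooth_continuous; exact: smooth_plateau.
have [] := @dominated_convergence _ _ _ mu (edge_int l) (measurable_edge_intR l)
  f_ (EFin \o (u \_ (edge_int d))) (abse \o (EFin \o u)).
- move=> n; apply/measurable_EFinP; apply: measurable_funM => //.
  by apply: measurable_funTS; exact: continuous_measurable_fun.
- apply/measurable_EFinP; apply/measurable_restrict => //.
  apply: measurable_funS mu_; [exact: measurable_edge_int|by move=> x []].
- apply: aeW => x xl; apply: cvg_EFin; first exact: nearW.
  rewrite /= patchE; case: ifPn => [/set_mem|] xd.
    have xd' : 0 < x < d by move: xd; rewrite /edge_int /= in_itv.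
    have := cvgM (cvg_cst (u x)) (plateau_cvg xd'); rewrite mulr1; exact.
  rewrite [X in X @ _ --> _](_ : _ = fun=> 0); first exact: cvg_cst.
  apply/funext => n; rewrite /f_ /= plateau_eq0 ?mulr0//; apply: contra xd => /andP[xa xd].
  apply/mem_set; rewrite /edge_int /= in_itv /=.
  rewrite (lt_le_trans _ xa) ?add0r ?invr_gt0//= (le_lt_trans xd)//.
  by rewrite ltrBlDr ltrDl invr_gt0.
- exact: integrable_abse.
- apply: aeW => x n _ /=; rewrite lee_fin normrM ler_piMr// ger0_norm ?plateau_ge0//.
  exact: plateau_le1.
move=> _ _.
rewrite [X in X @ _ --> _](_ : _ = fun=> 0%E); last first.
  apply/funext => n; have := utest _ (test_fun_plateau n (lexx 0) dl).
  rewrite /Rintegral => H; rewrite -[LHS]fineK ?H//.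
  apply: integrable_fin_num => //; apply: L1M_continuous => //.
  exact: continuous_subspaceT.
move=> /(cvg_lim (@ereal_hausdorff R)); rewrite lim_cst//.
move=> H; rewrite /Rintegral.
have -> : (\int[mu]_(x in edge_int d) (u x)%:E =
   \int[mu]_(x in edge_int l) (EFin \o u \_ (edge_int d)) x)%E.
  under [in RHS]eq_integral do rewrite -restrict_EFin.
  rewrite -integral_mkcondr setIidr//; exact: sub_edge_int.
by rewrite -H.
Qed.

(** The integral of [u] from 0 vanishes identically, and by Lebesgue's theorem
    it has derivative [u] almost everywhere. *)
Lemma du_Bois_Reymond_real l u : 0 < l -> L1 l u ->
  (forall phi, test_fun l phi -> Rintegral mu (edge_int l) (fun x => u x * phi x) = 0) ->
  ae_eq mu (edge_int l) u (fun=> 0).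
Proof.
move=> l0 ul /(Rintegral_edge_eq0 l0 ul) u0.
have iu := L1_restrict ul.
have iy y : mu.-integrable [set` Interval (BLeft 0) (BRight y)]
    (EFin \o (u \_ (edge_int l))) by exact: integrableS iu.
pose F x := Rintegral mu `[0, x] (u \_ (edge_int l)).
have := FTC1 iy (integrable_locally (measurable_edge_intR l) ul).
rewrite -/F /=; apply: filterS; first exact: (ae_filter_ringOfSetsType mu).
move=> x /[swap] xl.
have /andP[x0 xl'] : 0 < x < l by move: xl; rewrite /edge_int /= in_itv.
rewrite lte_fin => /(_ x0) [_].
rewrite patchE mem_set// => <-.
rewrite derive1E.
have /@derive_val // : is_derive x (1:R) F 0.
apply: near_eq_is_derive (is_derive_cst (0:R) x 1).
near=> y.
have y0 : 0 < y by near: y; exact: lt_nbhsr.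
have yl : y < l by near: y; exact: lt_nbhsl.
have y0l : 0 <= y <= l by rewrite !ltW.
have ul' : L1 l (u \_ (edge_int l)).
  by apply: L1_eq ul => z zl; rewrite patchE mem_set.
rewrite /F -/(parameterized_integral mu 0 y _) -(edge_intE y0l ul').
rewrite -[LHS](u0 y)//; apply: eq_Rintegral => z /set_mem zy.
by rewrite mem_set//; apply: sub_edge_int zy; exact: ltW.
Unshelve. all: by end_near. Qed.

Lemma du_Bois_Reymond l f : 0 < l -> cL1 l f ->
  (forall phi, test_fun l phi -> cintegral l (fun x => f x * (phi x)%:C%C) = 0) ->
  aeq l f (fun=> 0).
Proof.
move=> l0 [fr fi] ftest.
have fr0 : ae_eq mu (edge_int l) (Re \o f) (fun=> 0).
  apply: du_Bois_Reymond_real => // phi /ftest /(congr1 Re) /= H; rewrite -[RHS]H.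
  apply: eq_Rintegral => x _; by rewrite cReM /= mulr0 subr0.
have fi0 : ae_eq mu (edge_int l) (Im \o f) (fun=> 0).
  apply: du_Bois_Reymond_real => // phi /ftest /(congr1 Im) /= H; rewrite -[RHS]H.
  by apply: eq_Rintegral => x _; rewrite cImM /= mulr0 add0r.
apply: filterS2 fr0 fi0 => x fr0 fi0 xl.
by apply: complex_eqP; [exact: fr0|exact: fi0].
Qed.

Lemma test_fun_L1 l phi : test_fun l phi -> L1 l phi.
Proof. by move=> /test_fun_within; exact: L1_continuous. Qed.

Lemma mu_edge_int l : 0 <= l -> mu (edge_int l) = l%:E.
Proof.
move=> l0; rewrite lebesgue_measure_itv /= lte_fin.
case: ltP => [_|l0']; first by rewrite oppr0 addr0.
by congr EFin; apply/le_anti; rewrite l0 l0'.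
Qed.

Lemma Rintegral_edge_cst l a : 0 <= l -> Rintegral mu (edge_int l) (fun=> a) = a * l.
Proof.
move=> l0; rewrite Rintegral_cst//; congr (_ * _).
exact: (congr1 fine (mu_edge_int l0)).
Qed.

(** If all test functions had integral zero, the constant 1 would be orthogonal
    to them, and the interval would have length zero. *)
Lemma exists_normalized_test_fun l : 0 < l ->
  exists2 eta, test_fun l eta & Rintegral mu (edge_int l) eta = 1.
Proof.
move=> l0; apply: contrapT => /forall2NP noeta.
have t0 phi : test_fun l phi -> Rintegral mu (edge_int l) phi = 0.
  move=> tphi; apply: contrapT => /eqP phi0.
  set I := Rintegral mu (edge_int l) phi in phi0.
  have t1 : test_fun l (fun x => 0 + I^-1 * phi x).
    have := test_funD (I^-1 - 1) tphi tphi; congr test_fun.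
    by apply/funext => x; ring.
  have [//|] := noeta (fun x => 0 + I^-1 * phi x); apply.
  rewrite RintD; [|exact: L1_cst|exact/L1Z/test_fun_L1].
  by rewrite RintZ ?Rintegral_edge_cst ?ltW// ?mul0r ?add0r ?mulVf//; exact: test_fun_L1.
have := Rintegral_edge_eq0 l0 (L1_cst l 1) _ (d := l).
rewrite lexx ltW// Rintegral_edge_cst ?ltW// mul1r => H.
suff l00 : l = 0 by rewrite l00 ltxx in l0.
apply: H => // phi /t0 H; rewrite -[RHS]H.
by apply: eq_Rintegral => x _; rewrite mul1r.
Qed.

(** The integral from minus infinity is zero on the left of the support, and on
    its right because the total integral is zero. *)
Lemma test_fun_primitive l phi : test_fun l phi ->
  Rintegral mu (edge_int l) phi = 0 ->
  exists2 Phi, test_fun l Phi & derive1 Phi = phi.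
Proof.
move=> tphi phi0; have [sphi [a [b [a0 bl ab]]]] := tphi.
have phiD : phi \_ (edge_int l) = phi.
  apply/funext => x; rewrite patchE; case: ifPn => // xl.
  rewrite ab//; apply: contra xl => /andP[ax xb]; apply/mem_set.
  by rewrite /edge_int /= in_itv /= (lt_le_trans a0)//= (le_lt_trans xb).
have iphi : mu.-integrable setT (EFin \o phi).
  by rewrite -phiD; exact: L1_restrict (test_fun_L1 tphi).
pose Phi x := Rintegral mu `]-oo, x] phi.
have dPhi x : is_derive x (1:R) Phi (phi x).
  have [] := @continuous_FTC1 R phi -oo%O x (x + 1) _ _ _ _.
  - by rewrite ltrDl.
  - exact: integrableS iphi.
  - by rewrite ltNyr.
  - exact: test_fun_continuous tphi _.
  - by move=> d1 d2; rewrite -d2 derive1E; exact: derivableP.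
exists Phi; last by apply/funext => x; rewrite derive1E; exact: derive_val.
split; first exact: smooth_primitive dPhi sphi.
exists a, b; split => // x; rewrite negb_and -!ltNge => /orP[xa|bx].
  rewrite /Phi Rintegral_mkcond (_ : _ \_ _ = fun=> 0).
    by rewrite /Rintegral integral0.
  apply/funext => y; rewrite patchE; case: ifPn => // /set_mem.
  rewrite /= in_itv /= => yx.
  by rewrite ab// negb_and -ltNge (le_lt_trans yx).
rewrite /Phi -phi0 Rintegral_mkcond [RHS]Rintegral_mkcond phiD; congr Rintegral.
apply/funext => y; rewrite patchE; case: ifPn => // yx.
rewrite ab// negb_and -!ltNge; apply/orP; right.
rewrite (lt_trans bx)// ltNge; apply: contra yx => yx.
by apply/mem_set; rewrite /= in_itv.
Qed.

(** Subtracting from a test function the multiple of a fixed [eta] that has the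
    same integral makes it the derivative of a test function. A functional is
    therefore determined, up to a multiple of the integral, by its values on
    derivatives. *)
Lemma test_fun_split l eta phi : test_fun l eta ->
  Rintegral mu (edge_int l) eta = 1 -> test_fun l phi ->
  exists2 Phi, test_fun l Phi &
    derive1 Phi = fun x => phi x + - Rintegral mu (edge_int l) phi * eta x.
Proof.
move=> teta eta1 tphi; apply: test_fun_primitive; first exact: test_funD.
rewrite RintD; [|exact: test_fun_L1|exact/L1Z/test_fun_L1].
by rewrite RintZ ?eta1 ?mulr1 ?subrr//; exact: test_fun_L1.
Qed.

Lemma cintegral_real l u : 0 <= l ->
  cintegral l (fun x => (u x)%:C%C) = (Rintegral mu (edge_int l) u)%:C%C.
Proof.
by move=> l0; apply: complex_eqP => //=; rewrite Rintegral_edge_cst// mul0r.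
Qed.

End DuBoisReymond.


(** * Weak derivatives *)

Section WeakDerivative.
Variable R : realType.
Local Notation mu := (@lebesgue_measure R).
Local Notation Re := (@complex.Re R).
Local Notation Im := (@complex.Im R).
Implicit Types (l : R) (u v phi : R -> R) (f g : R -> R[i]) (c : R[i]).

Lemma aeq_refl l f : aeq l f f.
Proof. exact: aeW. Qed.

Lemma aeq_sym l f g : aeq l f g -> aeq l g f.
Proof. by apply: filterS => x H /H. Qed.

Lemma aeq_trans l f g h : aeq l f g -> aeq l g h -> aeq l f h.
Proof. by apply: filterS2 => x fg gh xl; rewrite fg// gh. Qed.

Lemma aeq_eq l f g : (forall x, edge_int l x -> f x = g x) -> aeq l f g.
Proof. by move=> fg; apply: aeW. Qed.

Lemma aeqD l f f' g g' : aeq l f f' -> aeq l g g' ->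
  aeq l (fun x => f x + g x) (fun x => f' x + g' x).
Proof. by apply: filterS2 => x ff gg xl; rewrite ff// gg. Qed.

Lemma aeqM l f f' g g' : aeq l f f' -> aeq l g g' ->
  aeq l (fun x => f x * g x) (fun x => f' x * g' x).
Proof. by apply: filterS2 => x ff gg xl; rewrite ff// gg. Qed.

Lemma aeq_conj l f g : aeq l f g ->
  aeq l (fun x => conjc (f x)) (fun x => conjc (g x)).
Proof. by apply: filterS => x H xl; rewrite H. Qed.

Lemma aeqB0 l f g : aeq l (fun x => f x - g x) (fun=> 0) -> aeq l f g.
Proof. by apply: filterS => x H xl; apply/eqP; rewrite -subr_eq0 H. Qed.

Lemma L2_cst l c : L2 l (fun=> c).
Proof. by apply/L2P; split; exact: sq_int_cst. Qed.

Lemma L2_continuous l f : {within `[0, l], continuous (Re \o f)} ->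
  {within `[0, l], continuous (Im \o f)} -> L2 l f.
Proof. by move=> fr fi; apply/L2P; split; exact: continuous_sq_int. Qed.

Lemma L2_real l u : continuous u -> L2 l (fun x => (u x)%:C%C).
Proof.
move=> cu; apply: L2_continuous; first exact: continuous_subspaceT.
by move=> x; exact: cst_continuous.
Qed.

Lemma test_fun_L2 l phi n : test_fun l phi -> L2 l (fun x => (derive1n n phi x)%:C%C).
Proof.
move=> [sp _]; apply: L2_real; apply: smooth_continuous => m x.
rewrite /derive1n -iterD; exact: sp.
Qed.

Lemma aeq_cintegralM l f g h : aeq l f g -> L2 l f -> L2 l g -> L2 l h ->
  cintegral l (fun x => f x * h x) = cintegral l (fun x => g x * h x).
Proof.
move=> fg fl gl hl; apply: aeq_cintegral; [|exact: cL1M..].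
by apply: aeqM fg _; exact: aeq_refl.
Qed.

Lemma is_wderiv_aeq l n f f' g : aeq l f f' -> L2 l f -> L2 l f' ->
  is_wderiv l n f g -> is_wderiv l n f' g.
Proof.
move=> ff fl fl' [gl fg]; split => // phi tphi; rewrite -fg//.
by apply: aeq_cintegralM (aeq_sym ff) _ _ _ => //; exact: test_fun_L2 tphi.
Qed.

Lemma is_wderiv_aeqr l n f g g' : aeq l g g' -> L2 l g' ->
  is_wderiv l n f g -> is_wderiv l n f g'.
Proof.
move=> gg gl' [gl fg]; split => // phi tphi; rewrite fg//; congr (_ * _).
by apply: aeq_cintegralM gg _ _ _ => //; exact: (@test_fun_L2 _ _ 0 tphi).
Qed.

Lemma is_wderiv_unique l n f g g' : 0 < l -> is_wderiv l n f g ->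
  is_wderiv l n f g' -> aeq l g g'.
Proof.
move=> l0 [gl fg] [gl' fg']; apply/aeqB0/du_Bois_Reymond => // [|phi tphi].
  by apply: L2_cL1; exact: L2B.
have L := @test_fun_L2 _ _ 0 tphi.
have := fg' _ tphi; rewrite fg// => /(mulfI (negbT (signr_eq0 _ n))) E.
rewrite (@eq_cintegral _ l _ (fun x => g x * (phi x)%:C%C - g' x * (phi x)%:C%C)).
  by rewrite cintegralB ?E ?subrr//; exact: cL1M.
by move=> x _; rewrite mulrBl.
Qed.

Lemma is_wderiv0 l f : L2 l f -> is_wderiv l 0 f f.
Proof. by move=> fl; split => // phi _; rewrite expr0 mul1r. Qed.

Lemma is_wderivD l n f f' g g' : L2 l f -> L2 l g ->
  is_wderiv l n f f' -> is_wderiv l n g g' ->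
  is_wderiv l n (fun x => f x + g x) (fun x => f' x + g' x).
Proof.
move=> fl gl [fl' ff] [gl' gg]; split=> [|phi tphi]; first exact: L2D.
have L := @test_fun_L2 _ _ n tphi; have L0 := @test_fun_L2 _ _ 0 tphi.
under eq_cintegral do rewrite mulrDl.
under [in RHS]eq_cintegral do rewrite mulrDl.
by rewrite !cintegralD ?ff ?gg ?mulrDr//; exact: cL1M.
Qed.

Lemma is_wderivZ l n c f f' : L2 l f ->
  is_wderiv l n f f' -> is_wderiv l n (fun x => c * f x) (fun x => c * f' x).
Proof.
move=> fl [fl' ff]; split=> [|phi tphi]; first exact: L2Z.
have L := @test_fun_L2 _ _ n tphi; have L0 := @test_fun_L2 _ _ 0 tphi.
under eq_cintegral do rewrite -mulrA.
under [in RHS]eq_cintegral do rewrite -mulrA.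
by rewrite !cintegralZ ?ff ?(mulrCA c)//; exact: cL1M.
Qed.

Lemma is_wderiv_conj l n f f' : L2 l f -> is_wderiv l n f f' ->
  is_wderiv l n (fun x => conjc (f x)) (fun x => conjc (f' x)).
Proof.
move=> fl [fl' ff]; split=> [|phi tphi]; first exact: L2_conj.
have L := @test_fun_L2 _ _ n tphi; have L0 := @test_fun_L2 _ _ 0 tphi.
have E (h : R -> R[i]) (v : R -> R) x : conjc (h x) * (v x)%:C%C = conjc (h x * (v x)%:C%C).
  by apply: complex_eqP; rewrite !ReImE /=; ring.
under eq_cintegral do rewrite E.
under [in RHS]eq_cintegral do rewrite E.
rewrite !cintegral_conj ?ff//; [|exact: cL1M..].
by rewrite rmorphM rmorphXn rmorphN1.
Qed.

Lemma wderivP l n f : (exists g, is_wderiv l n f g) -> is_wderiv l n f (wderiv l n f).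
Proof.
move=> fg; rewrite /wderiv; case: xgetP => [g -> //|H].
by case: fg => g /H.
Qed.

Lemma wderiv_aeq l n f g : 0 < l -> is_wderiv l n f g -> aeq l (wderiv l n f) g.
Proof.
move=> l0 fg; have H : is_wderiv l n f (wderiv l n f) by apply: wderivP; exists g.
exact: is_wderiv_unique l0 H fg.
Qed.

Lemma primitive_smooth l u : 0 < l -> smooth u ->
  primitive l (fun x => (u x)%:C%C) (fun x => (derive1 u x)%:C%C).
Proof.
move=> l0 su; apply: primitive_derive => // [x|]; first exact: smooth_is_derive.
by apply: smooth_continuous; exact: smooth_derive1.
Qed.

Lemma primitive_is_wderiv l F f : 0 < l -> primitive l F f -> L2 l f ->
  is_wderiv l 1 F f.
Proof.
move=> l0 pF fl; split=> // phi tphi.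
have FL := primitive_L2 l0 pF.
have := primitive_by_parts l0 pF (primitive_smooth l0 tphi.1).
rewrite (test_fun0 tphi) (test_funl tphi) !mulr0 subrr.
have Lp := @test_fun_L2 _ _ 0 tphi; have Lp' := @test_fun_L2 _ _ 1 tphi.
rewrite cintegralD; [|exact: cL1M..].
by move=> /eqP; rewrite addrC addr_eq0 => /eqP ->; rewrite expr1 mulN1r.
Qed.

(** The constant is the integral of [f] against a test function [eta] of
    integral 1, because [f] annihilates [phi - m eta], [m] the integral of
    [phi]. *)
Lemma is_wderiv0_cst l f : 0 < l -> L2 l f -> is_wderiv l 1 f (fun=> 0) ->
  exists c, aeq l f (fun=> c).
Proof.
move=> l0 fl [_ f0]; have [eta teta eta1] := exists_normalized_test_fun l0.
have Le := @test_fun_L2 _ _ 0 teta.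
exists (cintegral l (fun x => f x * (eta x)%:C%C)); set K := cintegral _ _.
apply/aeqB0/du_Bois_Reymond => // [|phi tphi].
  by apply: L2_cL1; apply: L2B => //; exact: L2_cst.
have Lp := @test_fun_L2 _ _ 0 tphi.
set m := Rintegral mu (edge_int l) phi.
have [Phi tPhi dPhi] := test_fun_split teta eta1 tphi; rewrite -/m in dPhi.
have := f0 _ tPhi.
rewrite [X in _ = _ * X]cintegral_eq0 => [|x _]; last by rewrite mul0r.
rewrite mulr0 derive1n1 dPhi => E.
have mE := cintegral_real phi (ltW l0).
rewrite (@eq_cintegral _ l _ (fun x => f x * (phi x)%:C%C - K * (phi x)%:C%C)) => [|x _]; last first.
  by rewrite mulrBl.
rewrite cintegralB; [|exact: cL1M|exact/cL1Z/L2_cL1].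
rewrite cintegralZ; last exact: L2_cL1.
rewrite mE -[RHS]E /K.
rewrite (@eq_cintegral _ l (fun x => f x * (phi x + - m * eta x)%:C%C) (fun x => f x * (phi x)%:C%C - m%:C%C * (f x * (eta x)%:C%C))).
  rewrite cintegralB; [|exact: cL1M|exact/cL1Z/cL1M].
  by rewrite cintegralZ ?[m%:C%C * _]mulrC//; exact: cL1M.
move=> x _; rewrite rmorphD rmorphM rmorphN /=; ring.
Qed.

(** The difference of [f] and a primitive of [g] has weak derivative zero. *)
Lemma is_wderiv_primitive l f g : 0 < l -> L2 l f -> is_wderiv l 1 f g ->
  exists2 F, primitive l F g & aeq l f F.
Proof.
move=> l0 fl fg; have [gl _] := fg.
have pG := primitive_cintegral (L2_cL1 gl).
have GL := primitive_L2 l0 pG.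
have [||c fGc] := @is_wderiv0_cst l (fun x => f x + -1 * cintegral x g) l0.
- by apply: L2D => //; exact: L2Z.
- have := is_wderivD fl (L2Z (-1) GL) fg
    (is_wderivZ (-1) GL (primitive_is_wderiv l0 pG gl)).
  by apply: is_wderiv_aeqr; [apply: aeq_eq => x _; ring|exact: L2_cst].
exists (fun x => cintegral x g + c).
  have := primitiveD pG (primitive_cst l c).
  by congr primitive; apply/funext => x; rewrite addr0.
apply: filterS fGc => x H xl; rewrite -H//; ring.
Qed.

(** With [G] a primitive of the second derivative and [Phi' = phi - m eta], the
    hypothesis at [Phi] says that the integral of [f (phi' - m eta')] is minus
    that of [G (phi - m eta)]; so the first derivative of [f] is [G - K], where
    the constant [K] collects the contributions of [eta]. *)
Lemma is_wderiv2_1 l f g : 0 < l -> L2 l f -> is_wderiv l 2 f g ->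
  exists f', is_wderiv l 1 f f'.
Proof.
move=> l0 fl [gl fg]; have [eta teta eta1] := exists_normalized_test_fun l0.
have pG := primitive_cintegral (L2_cL1 gl).
have GL := primitive_L2 l0 pG; have [_ wG] := primitive_is_wderiv l0 pG gl.
have Le := @test_fun_L2 _ _ 0 teta; have Le' := @test_fun_L2 _ _ 1 teta.
pose K := cintegral l (fun x => cintegral x g * (eta x)%:C%C) +
          cintegral l (fun x => f x * (derive1 eta x)%:C%C).
exists (fun x => cintegral x g - K); split => [|phi tphi].
  by apply: L2B => //; exact: L2_cst.
have Lp := @test_fun_L2 _ _ 0 tphi; have Lp' := @test_fun_L2 _ _ 1 tphi.
set m := Rintegral mu (edge_int l) phi.
have [Phi tPhi dPhi] := test_fun_split teta eta1 tphi; rewrite -/m in dPhi.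
have d2Phi x : derive1n 2 Phi x = derive1 phi x - m * derive1 eta x.
  rewrite -derive1nSr derive1n1 dPhi derive1E.
  have d1 := smooth_is_derive x tphi.1; have d2 := smooth_is_derive x teta.1.
  have /@derive_val -> // : is_derive x (1:R) (fun x => phi x + - m * eta x)
    (derive1 phi x - m * derive1 eta x).
  by rewrite -mulNr; apply: is_deriveD.
have mE := cintegral_real phi (ltW l0).
have I1 : cL1 l (fun x => f x * (derive1 phi x)%:C%C) := cL1M fl Lp'.
have I2 : cL1 l (fun x => f x * (derive1 eta x)%:C%C) := cL1M fl Le'.
have I3 : cL1 l (fun x => cintegral x g * (phi x)%:C%C) := cL1M GL Lp.
have I4 : cL1 l (fun x => cintegral x g * (eta x)%:C%C) := cL1M GL Le.
have E2 := fg _ tPhi; have E1 := wG _ tPhi.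
rewrite (@eq_cintegral _ l (fun x => f x * _)
   (fun x => f x * (derive1 phi x)%:C%C - m%:C%C * (f x * (derive1 eta x)%:C%C))) in E2; last first.
  by move=> x _; rewrite d2Phi rmorphB rmorphM /=; ring.
rewrite (cintegralB I1 (cL1Z _ I2)) (cintegralZ _ I2) in E2.
rewrite derive1n1 dPhi in E1.
rewrite (@eq_cintegral _ l (fun x => cintegral x g * _)
   (fun x => cintegral x g * (phi x)%:C%C - m%:C%C * (cintegral x g * (eta x)%:C%C))) in E1; last first.
  by move=> x _; rewrite rmorphD rmorphM rmorphN /=; ring.
rewrite (cintegralB I3 (cL1Z _ I4)) (cintegralZ _ I4) in E1.
rewrite (@eq_cintegral _ l (fun x => (cintegral x g - K) * _)
   (fun x => cintegral x g * (phi x)%:C%C - K * (phi x)%:C%C)); last first.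
  by move=> x _; rewrite mulrBl.
rewrite (cintegralB I3 (cL1Z _ (L2_cL1 Lp))) (cintegralZ _ (L2_cL1 Lp)).
rewrite mE derive1n1 /K.
move: E1 E2; rewrite expr1 mulN1r expr2 mulrNN mul1r => E1 E2.
move/eqP: E1; rewrite eq_sym eqr_oppLR => /eqP E1.
rewrite E1 in E2; move/eqP: E2; rewrite subr_eq => /eqP ->; ring.
Qed.

End WeakDerivative.


(** * Sobolev functions on an edge and their traces *)

Section SobolevEdge.
Variable R : realType.
Local Notation mu := (@lebesgue_measure R).
Local Notation Re := (@complex.Re R).
Local Notation Im := (@complex.Im R).
Implicit Types (l : R) (b : bool) (u v phi : R -> R) (f g F : R -> R[i]) (c : R[i]).

Definition edge_end l b : R := if b then l else 0.

Lemma ae_edge_inhabited l (P : R -> Prop) (a b : R) : a < b -> 0 <= a -> b <= l ->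
  {ae mu, forall x, edge_int l x -> P x} -> exists2 x, a < x < b & P x.
Proof.
move=> ab a0 bl aeP; apply: contrapT => nP.
have : mu.-negligible `]a, b[%classic.
  apply: negligibleS aeP => x /=; rewrite in_itv /= => xab H; apply: nP.
  exists x => //; apply: H; rewrite /edge_int /= in_itv /=.
  by case/andP: xab => ax xb; rewrite (le_lt_trans a0)//= (lt_le_trans xb).
move=> N; have : mu `]a, b[%classic = 0%E.
  by apply: measure_negligible N; exact: measurable_itv.
rewrite lebesgue_measure_itv /= lte_fin ab => /eqP.
by rewrite -EFinB eqe subr_eq0 gt_eqF.
Qed.

(** A continuous function that is nonzero at an end is nonzero on an interval
    next to it, which has positive measure; traces are unique by this. *)
Lemma within_ae_eq0_ends l u : 0 < l -> {within `[0, l], continuous u} ->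
  ae_eq mu (edge_int l) u (fun=> 0) -> forall b, u (edge_end l b) = 0.
Proof.
move=> l0 /(continuous_within_itvP _ l0)[_ u0 ul] uae b; apply/eqP/negPn/negP => ub.
case: b ub => /= ub.
  have := cvgr_neq0 _ ul ub => -[e /= e0 He].
  have [x /andP[xl lx] ux] : exists2 x, Num.max 0 (l - e) < x < l & u x = 0.
    apply: (ae_edge_inhabited _ _ _ uae); last exact: lexx.
      by rewrite gt_max l0 ltrBlDr ltrDl.
    by rewrite le_max lexx.
  move: xl; rewrite gt_max => /andP[x0 xe].
  have := He x; rewrite /= ux eqxx => H; suff: false by [].
  by apply: H => //; rewrite gtr0_norm ?subr_gt0// ltrBlDr addrC -ltrBlDr.
have := cvgr_neq0 _ u0 ub => -[e /= e0 He].
have [x /andP[x0 xe] ux] : exists2 x, 0 < x < Num.min l e & u x = 0.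
  apply: (ae_edge_inhabited _ _ _ uae); last by rewrite ge_min lexx.
    by rewrite lt_min l0.
  exact: lexx.
move: xe; rewrite lt_min => /andP[xl xe].
have := He x; rewrite /= ux eqxx => H; suff: false by [].
by apply: H => //; rewrite sub0r normrN gtr0_norm.
Qed.

Lemma is_trace_unique l b f c c' : 0 < l -> is_trace l b f c ->
  is_trace l b f c' -> c = c'.
Proof.
move=> l0 [h [hr hi hf <-]] [h' [hr' hi' hf' <-]].
have hh : aeq l h h' by apply: aeq_trans hf _; exact: aeq_sym.
have D (p : R[i] -> R) : {within `[0, l], continuous (p \o h)} ->
    {within `[0, l], continuous (p \o h')} ->
    p (h (edge_end l b)) = p (h' (edge_end l b)).
  move=> ch ch'; apply/eqP; rewrite -subr_eq0; apply/eqP.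
  apply: (@within_ae_eq0_ends l (fun x => p (h x) - p (h' x))) => //.
    by move=> x; apply: cvgB; [exact: ch|exact: ch'].
  by apply: filterS hh => x H xl; rewrite H// subrr.
by apply: complex_eqP; apply: D.
Qed.

Lemma traceE l b f F g : 0 < l -> primitive l F g -> aeq l f F ->
  trace l b f = F (edge_end l b).
Proof.
move=> l0 pF fF; have [Fr Fi] := primitive_continuous l0 pF.
have tF : is_trace l b f (F (edge_end l b)).
  by exists F; split => //; exact: aeq_sym.
rewrite /trace; case: xgetP => [c _ tc|/(_ _ tF)//].
exact: is_trace_unique tc tF.
Qed.

Lemma trace_aeq l b f g : aeq l f g -> trace l b f = trace l b g.
Proof.
move=> fg; rewrite /trace; congr xget; apply/seteqP; split=> c [h [hr hi hf hc]].
  by exists h; split => //; exact: aeq_trans hf fg.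
by exists h; split => //; apply: aeq_trans hf (aeq_sym fg).
Qed.

Lemma sobolevW l k k' f : (k' <= k)%N -> sobolev l k f -> sobolev l k' f.
Proof. by move=> kk [fl H]; split => // j jk; apply: H; exact: leq_trans kk. Qed.

Lemma sobolev1P l f : sobolev l 1 f <-> L2 l f /\ exists g, is_wderiv l 1 f g.
Proof.
split=> [[fl H]|[fl fg]]; first by split => //; exact: H.
split => // -[|[|//]] _ //; exists f; exact: is_wderiv0.
Qed.

Lemma sobolev2P l f : 0 < l ->
  sobolev l 2 f <-> L2 l f /\ exists g, is_wderiv l 2 f g.
Proof.
move=> l0; split=> [[fl H]|[fl [g fg]]]; first by split => //; exact: H.
split => // -[|[|[|//]]] _; last by exists g.
  by exists f; exact: is_wderiv0.
exact: is_wderiv2_1 fg.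
Qed.

Lemma sobolev_wderiv l k n f : (n <= k)%N -> sobolev l k f ->
  is_wderiv l n f (wderiv l n f).
Proof. by move=> nk [_ H]; apply: wderivP; exact: H. Qed.

Lemma wderiv_congr l n k f g : 0 < l -> (n <= k)%N -> aeq l f g -> L2 l g ->
  sobolev l k f -> aeq l (wderiv l n f) (wderiv l n g).
Proof.
move=> l0 nk fg gl fk; apply/aeq_sym/wderiv_aeq => //.
apply: is_wderiv_aeq fg _ gl _; first by case: fk.
exact: sobolev_wderiv nk fk.
Qed.

Lemma sobolevD l k f g : sobolev l k f -> sobolev l k g ->
  sobolev l k (fun x => f x + g x).
Proof.
move=> [fl H] [gl H']; split; first exact: L2D.
move=> j jk; have [h fh] := H _ jk; have [h' gh] := H' _ jk.
by exists (fun x => h x + h' x); exact: is_wderivD.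
Qed.

Lemma sobolev_conj l k f : sobolev l k f -> sobolev l k (fun x => conjc (f x)).
Proof.
move=> [fl H]; split; first exact: L2_conj.
by move=> j /H[h fh]; exists (fun x => conjc (h x)); exact: is_wderiv_conj.
Qed.

Lemma wderivD l n k f g : 0 < l -> (n <= k)%N -> sobolev l k f -> sobolev l k g ->
  aeq l (wderiv l n (fun x => f x + g x)) (fun x => wderiv l n f x + wderiv l n g x).
Proof.
move=> l0 nk fk gk; apply: wderiv_aeq => //.
by apply: is_wderivD; [case: fk|case: gk|exact: sobolev_wderiv fk|exact: sobolev_wderiv gk].
Qed.

Lemma wderiv_conj l n k f : 0 < l -> (n <= k)%N -> sobolev l k f ->
  aeq l (wderiv l n (fun x => conjc (f x))) (fun x => conjc (wderiv l n f x)).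
Proof.
move=> l0 nk fk; apply: wderiv_aeq => //.
by apply: is_wderiv_conj; [case: fk|exact: sobolev_wderiv fk].
Qed.

Lemma sobolev_primitive l f : 0 < l -> sobolev l 1 f ->
  exists2 F, primitive l F (wderiv l 1 f) & aeq l f F.
Proof.
move=> l0 f1; apply: is_wderiv_primitive => //; first by case: f1.
exact: sobolev_wderiv f1.
Qed.

Lemma traceD l b f g : 0 < l -> sobolev l 1 f -> sobolev l 1 g ->
  trace l b (fun x => f x + g x) = trace l b f + trace l b g.
Proof.
move=> l0 /(sobolev_primitive l0)[F pF fF] /(sobolev_primitive l0)[G pG gG].
rewrite (traceE _ l0 pF fF) (traceE _ l0 pG gG).
by rewrite (traceE _ l0 (primitiveD pF pG) (aeqD fF gG)).
Qed.

Lemma trace_conj l b f : 0 < l -> sobolev l 1 f ->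
  trace l b (fun x => conjc (f x)) = conjc (trace l b f).
Proof.
move=> l0 /(sobolev_primitive l0)[F pF fF].
by rewrite (traceE _ l0 pF fF) (traceE _ l0 (primitive_conj pF) (aeq_conj fF)).
Qed.

Lemma sobolev_by_parts l f g : 0 < l -> sobolev l 1 f -> sobolev l 1 g ->
  cintegral l (fun x => wderiv l 1 f x * g x + f x * wderiv l 1 g x) =
  trace l true f * trace l true g - trace l false f * trace l false g.
Proof.
move=> l0 f1 g1; have [F pF fF] := sobolev_primitive l0 f1.
have [G pG gG] := sobolev_primitive l0 g1.
rewrite !(traceE _ l0 pF fF) !(traceE _ l0 pG gG) -(primitive_by_parts l0 pF pG).
have [fl' _] := sobolev_wderiv (leqnn 1) f1.
have [gl' _] := sobolev_wderiv (leqnn 1) g1.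
have [[fl _] [gl _]] := (f1, g1).
have Fl := primitive_L2 l0 pF; have Gl := primitive_L2 l0 pG.
apply: aeq_cintegral; [|by apply: cL1D; exact: cL1M..].
by apply: aeqD; apply: aeqM => //; exact: aeq_refl.
Qed.

Lemma is_wderiv_comp l f g h : is_wderiv l 1 f g -> is_wderiv l 1 g h ->
  is_wderiv l 2 f h.
Proof.
move=> [_ fg] [hl gh]; split => // phi tphi.
rewrite [LHS](fg _ (test_fun_derive tphi)).
have E : cintegral l (fun x => g x * (derive1 phi x)%:C%C) = _ := gh _ tphi.
by rewrite E expr1 !mulN1r opprK expr2 mulrNN !mul1r.
Qed.

(** Second derivatives are defined without reference to first ones; derivatives
    of test functions, being test functions, relate the two. *)
Lemma is_wderiv_wderiv l f : sobolev l 2 f ->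
  is_wderiv l 1 (wderiv l 1 f) (wderiv l 2 f).
Proof.
move=> f2; have [_ w1] := sobolev_wderiv (isT : (1 <= 2)%N) f2.
have [l2 w2] := sobolev_wderiv (leqnn 2) f2.
split; [exact: l2|move=> phi tphi].
have E : cintegral l (fun x => f x * (derive1n 2 phi x)%:C%C) = _ :=
  w1 _ (test_fun_derive tphi).
rewrite w2// expr1 expr2 mulrNN !mul1r mulN1r in E.
by rewrite expr1 mulN1r E opprK.
Qed.

Lemma sobolev_wderiv1 l f : sobolev l 2 f -> sobolev l 1 (wderiv l 1 f).
Proof.
move=> f2; apply/sobolev1P; split.
  by have [] := sobolev_wderiv (isT : (1 <= 2)%N) f2.
by exists (wderiv l 2 f); exact: is_wderiv_wderiv.
Qed.

Lemma wderiv_wderiv l f : 0 < l -> sobolev l 2 f ->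
  aeq l (wderiv l 1 (wderiv l 1 f)) (wderiv l 2 f).
Proof. by move=> l0 f2; apply: wderiv_aeq => //; exact: is_wderiv_wderiv. Qed.

Lemma smooth_wderiv1 l u : 0 < l -> smooth u ->
  is_wderiv l 1 (fun x => (u x)%:C%C) (fun x => (derive1 u x)%:C%C).
Proof.
move=> l0 su; apply: primitive_is_wderiv; [by []|exact: primitive_smooth|].
by apply: L2_real; apply: smooth_continuous; exact: smooth_derive1.
Qed.

Lemma smooth_wderiv2 l u : 0 < l -> smooth u ->
  is_wderiv l 2 (fun x => (u x)%:C%C) (fun x => (derive1 (derive1 u) x)%:C%C).
Proof.
move=> l0 su; apply: is_wderiv_comp (smooth_wderiv1 l0 su) _.
apply: smooth_wderiv1; [exact: l0|exact: smooth_derive1].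
Qed.

Lemma smooth_sobolev2 l u : 0 < l -> smooth u -> sobolev l 2 (fun x => (u x)%:C%C).
Proof.
move=> l0 su; apply/sobolev2P => //; split.
  by apply: L2_real; exact: smooth_continuous.
by eexists; exact: smooth_wderiv2.
Qed.

Lemma trace_smooth l b u : 0 < l -> smooth u ->
  trace l b (fun x => (u x)%:C%C) = (u (edge_end l b))%:C%C.
Proof. by move=> l0 su; exact: traceE (primitive_smooth l0 su) (aeq_refl _ _). Qed.

Lemma trace_wderiv_smooth l b u : 0 < l -> smooth u ->
  trace l b (wderiv l 1 (fun x => (u x)%:C%C)) = (derive1 u (edge_end l b))%:C%C.
Proof.
move=> l0 su; rewrite (trace_aeq b (wderiv_aeq l0 (smooth_wderiv1 l0 su))).
apply: trace_smooth; [exact: l0|exact: smooth_derive1].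
Qed.

Lemma is_wderiv_cst l n c : 0 < l -> is_wderiv l n.+1 (fun=> c) (fun=> 0).
Proof.
move=> l0.
have c1 : is_wderiv l 1 (fun=> c) (fun=> 0).
  by apply: primitive_is_wderiv => //; [exact: primitive_cst|exact: L2_cst].
elim: n => // n [_ IH]; split=> [|phi tphi]; first exact: L2_cst.
have := IH _ (test_fun_derive tphi); rewrite derive1nSr => ->.
by rewrite !(@cintegral_eq0 _ l (fun x => 0 * _)) ?mulr0// => x _; rewrite mul0r.
Qed.

Lemma sobolev_cst l k c : 0 < l -> sobolev l k (fun=> c).
Proof.
move=> l0; split=> [|[|j] _]; first exact: L2_cst.
  by exists (fun=> c); exact/is_wderiv0/L2_cst.
by exists (fun=> 0); exact: is_wderiv_cst.
Qed.

Lemma trace_cst l b c : 0 < l -> trace l b (fun=> c) = c.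
Proof. by move=> l0; exact: traceE (primitive_cst l c) (aeq_refl _ _). Qed.

Lemma trace_cintegral l f : 0 < l -> sobolev l 1 f ->
  cintegral l (wderiv l 1 f) = trace l true f - trace l false f.
Proof.
move=> l0 f1; have [F pF fF] := sobolev_primitive l0 f1.
rewrite !(traceE _ l0 pF fF) /=; have [_ ->] := pF; first by rewrite addrAC subrr add0r.
by rewrite lexx ltW.
Qed.

Lemma wderiv_eq0_cst l f : 0 < l -> sobolev l 1 f -> aeq l (wderiv l 1 f) (fun=> 0) ->
  forall b, aeq l f (fun=> trace l b f).
Proof.
move=> l0 f1 f'0 b.
have [|c fc] := @is_wderiv0_cst _ l f l0 f1.1.
  by apply: is_wderiv_aeqr f'0 (L2_cst _ _) _; exact: sobolev_wderiv f1.
by rewrite (trace_aeq b fc) trace_cst.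
Qed.

Lemma Rintegral_eq0_ae l u : L1 l u -> {ae mu, forall x, edge_int l x -> 0 <= u x} ->
  0 <= Rintegral mu (edge_int l) u /\
  (Rintegral mu (edge_int l) u = 0 -> ae_eq mu (edge_int l) u (fun=> 0)).
Proof.
move=> ul u0.
have mu_ := L1_measurable ul.
have uE : ae_eq mu (edge_int l) u (fun x => `|u x|).
  move: u0; apply: filterS; first exact: (ae_filter_ringOfSetsType mu).
  by move=> x H xl; rewrite ger0_norm ?H.
have mn : measurable_fun (edge_int l) (fun x => `|u x|) by exact: measurableT_comp.
rewrite (ae_Rintegral mu_ mn uE); split.
  by apply: Rintegral_ge0 => x _.
move=> I0.
have : (\int[mu]_(x in edge_int l) `|(u x)%:E| = 0)%E.
  have un : L1 l (fun x => `|u x|) by exact: L1_ae uE ul.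
  rewrite -[LHS]fineK; last by apply: (integrable_fin_num _ un).
  by congr EFin.
move=> /ae_eq_integral_abs H.
have {}H := H (measurable_edge_intR l) ((measurable_EFinP _ _).2 mu_).
by apply: filterS H => x /= + xl => /(_ xl)[].
Qed.

End SobolevEdge.


(** * The adjoint of the minimal operator *)

Section Graph.
Variables (R : realType) (G : metric_graph R).
Local Notation mu := (@lebesgue_measure R).
Local Notation Re := (@complex.Re R).
Local Notation Im := (@complex.Im R).
Implicit Types (f g s k : gfun G) (p : edge G * bool) (v : vertex G).

Let l0 (e : edge G) : 0 < len e := len_gt0 e.

Definition maximal_domain : set (gfun G) := [set f | gsobolev 2 f /\ gH1 f].

Definition minimal_domain : set (gfun G) :=
  [set f | [/\ gsobolev 2 f, gH1 f &
               forall v, vanishes_at f v /\ normal_deriv f v = 0]].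

(** The summand of [normal_deriv]: the derivative at an edge end, in the
    direction out of the edge. *)
Definition outer_deriv p f : R[i] :=
  if p.2 then gtrace p (gwderiv 1 f) else - gtrace p (gwderiv 1 f).

Definition gconj f : gfun G := fun e x => conjc (f e x).

Lemma gsobolevW n m f : (m <= n)%N -> gsobolev n f -> gsobolev m f.
Proof. by move=> kk fk e; exact: sobolevW kk (fk e). Qed.

Lemma gsobolev_L2 n f : gsobolev n f -> gL2 f.
Proof. by move=> fk e; case: (fk e). Qed.

Lemma gsobolev_conj n f : gsobolev n f -> gsobolev n (gconj f).
Proof. by move=> fk e; exact: sobolev_conj. Qed.

Lemma gsobolev_wderiv_L2 n m f e : (n <= m)%N -> gsobolev m f ->
  L2 (len e) (wderiv (len e) n (f e)).
Proof. by move=> nk fk; have [] := sobolev_wderiv nk (fk e). Qed.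

Lemma gtraceD p f g : gsobolev 1 f -> gsobolev 1 g ->
  gtrace p (fun e x => f e x + g e x) = gtrace p f + gtrace p g.
Proof. by move=> f1 g1; rewrite /gtrace traceD. Qed.

Lemma gtrace_conj p f : gsobolev 1 f -> gtrace p (gconj f) = conjc (gtrace p f).
Proof. by move=> f1; rewrite /gtrace trace_conj. Qed.

Lemma gtrace_aeq p f g : gaeq f g -> gtrace p f = gtrace p g.
Proof. by move=> fg; apply: trace_aeq; exact: fg. Qed.

Lemma outer_deriv_aeq p f g : gaeq f g -> gL2 g -> gsobolev 1 f ->
  outer_deriv p f = outer_deriv p g.
Proof.
move=> fg gl f1; rewrite /outer_deriv (@gtrace_aeq p (gwderiv 1 f) (gwderiv 1 g))//.
by move=> e; apply: wderiv_congr (f1 e).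
Qed.

Lemma outer_derivD p f g : gsobolev 2 f -> gsobolev 2 g ->
  outer_deriv p (fun e x => f e x + g e x) = outer_deriv p f + outer_deriv p g.
Proof.
move=> f2 g2; rewrite /outer_deriv.
rewrite (@gtrace_aeq p _ (fun e x => gwderiv 1 f e x + gwderiv 1 g e x)); last first.
  by move=> e; apply: (wderivD _ _ (f2 e) (g2 e)).
rewrite gtraceD; [by case: ifP => // _; rewrite opprD|..].
  by move=> e; exact: sobolev_wderiv1.
by move=> e; exact: sobolev_wderiv1.
Qed.

Lemma normal_derivE f v : normal_deriv f v = \sum_(p | endpt p == v) outer_deriv p f.
Proof. by []. Qed.

Lemma normal_derivD f g v : gsobolev 2 f -> gsobolev 2 g ->
  normal_deriv (fun e x => f e x + g e x) v = normal_deriv f v + normal_deriv g v.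
Proof.
move=> f2 g2; rewrite !normal_derivE -big_split; apply: eq_bigr => p _.
exact: outer_derivD.
Qed.

Lemma normal_deriv_aeq f g v : gaeq f g -> gL2 g -> gsobolev 1 f ->
  normal_deriv f v = normal_deriv g v.
Proof.
move=> fg gl f1; rewrite !normal_derivE; apply: eq_bigr => p _.
exact: outer_deriv_aeq.
Qed.

(** Green's first identity; the boundary terms of an edge are the two summands
    that belong to its ends. *)
Lemma green f g : gsobolev 2 f -> gsobolev 1 g ->
  \sum_e cintegral (len e) (fun x => wderiv (len e) 2 (f e) x * g e x) =
  \sum_p outer_deriv p f * gtrace p g -
  \sum_e cintegral (len e) (fun x => wderiv (len e) 1 (f e) x * wderiv (len e) 1 (g e) x).
Proof.
move=> f2 g1.
rewrite -(pair_bigA _ (fun e b => outer_deriv (e, b) f * gtrace (e, b) g)) /=.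
rewrite -sumrB; apply: eq_bigr => e _.
rewrite big_bool /= /outer_deriv /gtrace /gwderiv /= mulNr.
have f1 := sobolev_wderiv1 (f2 e).
have gl := gsobolev_L2 g1 e.
have L1 := gsobolev_wderiv_L2 e (isT : (1 <= 2)%N) f2.
have L2_ := gsobolev_wderiv_L2 e (isT : (2 <= 2)%N) f2.
have L3 := gsobolev_wderiv_L2 e (isT : (1 <= 1)%N) g1.
rewrite -(sobolev_by_parts (l0 e) f1 (g1 e)).
have [L4 _] := sobolev_wderiv (leqnn 1) f1.
rewrite cintegralD; [|exact: cL1M..].
rewrite addrK; apply: aeq_cintegralM => //.
exact/aeq_sym/wderiv_wderiv.
Qed.

(** Group the edge ends by their vertices and factor out the common coefficient
    at each of them. *)
Lemma boundary_sum_eq0 f (c : edge G * bool -> R[i]) :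
  (forall v, normal_deriv f v = 0) ->
  (forall p p', endpt p = endpt p' -> c p = c p') ->
  \sum_p outer_deriv p f * c p = 0.
Proof.
move=> fv cv; rewrite (partition_big endpt xpredT) //= big1 // => v _.
case: (pickP (fun p => endpt p == v)) => [p0 /eqP p0v|np]; last first.
  by rewrite big_pred0.
rewrite (eq_bigr (fun p => outer_deriv p f * c p0)).
  by rewrite -mulr_suml -normal_derivE fv mul0r.
by move=> p /eqP pv; rewrite (cv p p0)// pv.
Qed.

Variable q : edge G -> R -> R.
Hypothesis qm : forall e, measurable_fun (edge_int (len e)) (q e).
Hypothesis qb : exists M : R, forall e x, edge_int (len e) x -> `|q e x| <= M.

Lemma potential_L2 f : gL2 f -> gL2 (fun e x => (q e x)%:C%C * f e x).
Proof.
move=> fl e; apply: L2Mb => //; have [M HM] := qb.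
by exists M; exact: HM.
Qed.

Definition schroedinger_fun f : gfun G :=
  fun e x => - gwderiv 2 f e x + (q e x)%:C%C * f e x.

Lemma schroedinger_fun_L2 f : gsobolev 2 f -> gL2 (schroedinger_fun f).
Proof.
move=> f2 e; apply: L2D.
  exact/L2N/(gsobolev_wderiv_L2 _ (isT : (2 <= 2)%N)).
by apply: potential_L2; exact: gsobolev_L2 f2.
Qed.

Lemma inner_schroedinger f g h : gsobolev 2 f -> gL2 g ->
  gL2 h -> gaeq h (schroedinger_fun f) ->
  inner h g =
  \sum_e cintegral (len e) (fun x => (q e x)%:C%C * f e x * gconj g e x) -
  \sum_e cintegral (len e) (fun x => wderiv (len e) 2 (f e) x * gconj g e x).
Proof.
move=> f2 gl hl hf; rewrite /inner -sumrB; apply: eq_bigr => e _.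
have gl' : L2 (len e) (gconj g e) by exact/L2_conj/gl.
rewrite (aeq_cintegralM (hf e))//; last exact: schroedinger_fun_L2.
have L2_ := gsobolev_wderiv_L2 e (isT : (2 <= 2)%N) f2.
have Lq := potential_L2 (gsobolev_L2 f2) e.
rewrite -cintegralB; [|exact: cL1M..].
by apply: eq_cintegral => x _; rewrite /schroedinger_fun /gwderiv mulrDl mulNr addrC.
Qed.

Lemma inner_gconj f g : inner (gconj f) (gconj g) = inner g f.
Proof.
rewrite /inner; apply: eq_bigr => e _; apply: eq_cintegral => x _.
by rewrite /gconj conjcK mulrC.
Qed.

Lemma gconjK f : gconj (gconj f) = f.
Proof. by apply/funext => e; apply/funext => x; exact: conjcK. Qed.

Lemma gaeq_conj f g : gaeq f g -> gaeq (gconj f) (gconj g).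
Proof. by move=> fg e; exact: aeq_conj. Qed.

Lemma schroedinger_fun_conj f : gsobolev 2 f ->
  gaeq (schroedinger_fun (gconj f)) (gconj (schroedinger_fun f)).
Proof.
move=> f2 e; have := wderiv_conj (l0 e) (leqnn 2) (f2 e).
apply: filterS => x H xl; rewrite /gconj /schroedinger_fun /gwderiv H//.
by apply: complex_eqP; rewrite !ReImE /=; ring.
Qed.

Lemma subr_cancel (V : zmodType) (a a' b c c' d : V) : a = a' -> c = c' ->
  (a - (b - c)) - (a' - (d - c')) = d - b.
Proof. by move=> -> ->; rewrite (opprB a') addrC addrA subrK opprB addrA subrK. Qed.

(** The potential terms cancel, and so do the products of first derivatives in
    Green's identity for [f] and the conjugate of [g], taken in both orders. *)
Lemma inner_symmetry f g h h' : gsobolev 2 f -> gsobolev 2 g ->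
  gL2 h -> gL2 h' -> gaeq h (schroedinger_fun f) -> gaeq h' (schroedinger_fun g) ->
  inner h g - inner f h' =
  \sum_p outer_deriv p (gconj g) * gtrace p f -
  \sum_p outer_deriv p f * gtrace p (gconj g).
Proof.
move=> f2 g2 hl hl' hf hg.
have gc2 := gsobolev_conj g2.
have f1 := gsobolevW (isT : (1 <= 2)%N) f2.
have gc1 := gsobolevW (isT : (1 <= 2)%N) gc2.
rewrite -(inner_gconj h' f) (inner_schroedinger f2 (gsobolev_L2 g2) hl hf).
rewrite (@inner_schroedinger (gconj g) (gconj f) (gconj h')) //; first last.
- by move=> e; exact: aeq_trans (gaeq_conj hg e) (aeq_sym (schroedinger_fun_conj g2 e)).
- by move=> e; exact/L2_conj/hl'.
- exact: gsobolev_L2 (gsobolev_conj f2).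
rewrite gconjK (green f2 gc1) (green gc2 f1).
apply: subr_cancel; apply: eq_bigr => e _; apply: eq_cintegral => x _.
  exact: mulrAC.
exact: mulrC.
Qed.

Lemma op_dom_schroedinger (D : set (gfun G)) f : (D f -> gsobolev 2 f) ->
  op_dom (schroedinger q D) f <-> D f.
Proof.
move=> D2; split=> [[g []//]|Df]; exists (schroedinger_fun f); split => //=.
  exact/schroedinger_fun_L2/D2.
by move=> e; exact: aeq_refl.
Qed.

Lemma vanishing_gtrace f p : (forall v, vanishes_at f v) -> gtrace p f = 0.
Proof. by move=> fv; exact: fv. Qed.

(** Of the two boundary sums, one vanishes since the traces of [s] do, the other
    since the outer derivatives of [s] add up to zero at every vertex, where [f]
    has a single value. *)
Lemma schroedinger_sub_adjoint :
  schroedinger q maximal_domain `<=` adjoint (S_op q).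
Proof.
move=> [f g] [/= [f2 [f1 fc]] gl gf]; split => //=; first exact: gsobolev_L2 f2.
move=> s t [/= [s2 [s1 sc] sv] tl ts].
apply/eqP; rewrite -subr_eq0 (inner_symmetry s2 f2 tl gl ts gf).
rewrite big1; last first.
  by move=> p _; rewrite vanishing_gtrace ?mulr0// => v; case: (sv v).
rewrite boundary_sum_eq0 ?subrr//; first by move=> v; case: (sv v).
by move=> p p' pp'; rewrite !gtrace_conj// (fc _ _ pp').
Qed.

Definition on_edge (e : edge G) (u : R -> R) : gfun G :=
  fun e' x => if e' == e then (u x)%:C%C else 0.

Lemma test_fun_minimal_domain e phi : test_fun (len e) phi ->
  minimal_domain (on_edge e phi).
Proof.
move=> tphi; have sphi := tphi.1.
have on_edgeE e' : on_edge e phi e' = if e' == e then (fun x => (phi x)%:C%C) else (fun=> 0).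
  by apply/funext => x; rewrite /on_edge; case: ifP.
have p2 : gsobolev 2 (on_edge e phi).
  move=> e'; rewrite on_edgeE; case: ifP => _; last exact: sobolev_cst.
  exact: smooth_sobolev2.
have p0 p : gtrace p (on_edge e phi) = 0.
  rewrite /gtrace on_edgeE; case: eqP => [pe|_]; last by rewrite trace_cst.
  rewrite trace_smooth// /edge_end pe; case: ifP => _.
    by rewrite (test_funl tphi).
  by rewrite (test_fun0 tphi).
have p0' p : outer_deriv p (on_edge e phi) = 0.
  suff H : gtrace p (gwderiv 1 (on_edge e phi)) = 0.
    by rewrite /outer_deriv H oppr0; case: ifP.
  rewrite /gtrace /gwderiv on_edgeE; case: eqP => [pe|_]; last first.
    by rewrite (trace_aeq _ (wderiv_aeq _ (is_wderiv_cst 0 _ _))) ?trace_cst.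
  rewrite trace_wderiv_smooth// /edge_end pe.
  have tphi' := test_fun_derive tphi.
  case: ifP => _; first by rewrite (test_funl tphi').
  by rewrite (test_fun0 tphi').
split => //; first by split => [|p p' _]; [exact: gsobolevW p2|rewrite !p0].
move=> v; split=> [p _|]; first exact: p0.
by rewrite normal_derivE big1// => p _; exact: p0'.
Qed.

(** Test functions on one edge lie in the domain of S, and the adjoint relation
    against them is the weak form of the differential equation. *)
Lemma adjoint_is_wderiv f g e : adjoint (S_op q) (f, g) ->
  is_wderiv (len e) 2 (f e) (fun x => (q e x)%:C%C * f e x - g e x).
Proof.
move=> [/= fl gl adj].
have Lqf : L2 (len e) (fun x => (q e x)%:C%C * f e x) by exact: potential_L2.
split; first by apply: L2B => //; exact: gl.
move=> phi tphi.
have mphi := test_fun_minimal_domain tphi.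
have [p2 _ _] := mphi.
have := adj (on_edge e phi) (schroedinger_fun (on_edge e phi)).
have Sphi : S_op q (on_edge e phi, schroedinger_fun (on_edge e phi)).
  split => //=; first exact: schroedinger_fun_L2.
  by move=> e'; exact: aeq_refl.
move=> /(_ Sphi).
rewrite (inner_schroedinger p2 fl (schroedinger_fun_L2 p2)); last first.
  by move=> e'; exact: aeq_refl.
have one (F : edge G -> R[i]) : (forall e', e' != e -> F e' = 0) -> \sum_e' F e' = F e.
  by move=> F0; rewrite (bigD1 e)//= big1 ?addr0.
rewrite /inner !one; first last.
- by move=> e' e'e; apply: cintegral_eq0 => x _; rewrite /on_edge (negbTE e'e) mulr0 mul0r.
- move=> e' e'e; rewrite (@aeq_cintegralM _ _ _ (fun=> 0)).
  + by apply: cintegral_eq0 => x _; rewrite mul0r.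
  + have -> : on_edge e phi e' = fun=> 0.
      by apply/funext => x; rewrite /on_edge (negbTE e'e).
    exact: wderiv_aeq (is_wderiv_cst _ _ _).
  + exact: gsobolev_wderiv_L2 p2.
  + exact: L2_cst.
  + exact/L2_conj/fl.
- by move=> e' e'e; apply: cintegral_eq0 => x _; rewrite /on_edge (negbTE e'e) mul0r.
have oe : on_edge e phi e = fun x => (phi x)%:C%C.
  by apply/funext => x; rewrite /on_edge eqxx.
rewrite oe.
rewrite (@aeq_cintegralM _ _ (wderiv (len e) 2 _) (fun x => (derive1n 2 phi x)%:C%C)); first last.
- exact/L2_conj/fl.
- exact: test_fun_L2.
- by rewrite -oe; exact: gsobolev_wderiv_L2 p2.
- exact: wderiv_aeq (l0 e) (smooth_wderiv2 (l0 e) tphi.1).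
have fl' := fl e; have gl' := gl e.
have Lp := test_fun_L2 0 tphi; have Lp2 := test_fun_L2 2 tphi.
have I1 := cL1M fl' Lp2; have I2 := cL1M Lqf Lp; have I3 := cL1M gl' Lp.
have conjE (h : R -> R[i]) (u : R -> R) : cL1 (len e) (fun x => h x * (u x)%:C%C) ->
    cintegral (len e) (fun x => (u x)%:C%C * conjc (h x)) =
    conjc (cintegral (len e) (fun x => h x * (u x)%:C%C)).
  move=> hu; rewrite -cintegral_conj//; apply: eq_cintegral => x _.
  by apply: complex_eqP; rewrite !ReImE /=; ring.
have -> : cintegral (len e) (fun x => (q e x)%:C%C * (phi x)%:C%C * gconj f e x) =
    conjc (cintegral (len e) (fun x => (q e x)%:C%C * f e x * (phi x)%:C%C)).
  rewrite -conjE//; apply: eq_cintegral => x _; rewrite /gconj.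
  by apply: complex_eqP; rewrite !ReImE /=; ring.
rewrite (conjE _ _ I1) (conjE _ _ I3) -rmorphB => /(can_inj (@conjcK R)) E.
rewrite (@eq_cintegral _ _ (fun x => ((q e x)%:C%C * f e x - g e x) * (phi x)%:C%C)
  (fun x => (q e x)%:C%C * f e x * (phi x)%:C%C - g e x * (phi x)%:C%C)); last first.
  by move=> x _; rewrite mulrBl.
by rewrite (cintegralB I2 I3) expr2 mulrNN !mul1r -E opprB addrC subrK.
Qed.

(** The cubic that vanishes at 0 and [l], with slope [a] at 0 and [b] at [l]. *)
Definition hermite (l a b : R) : {poly R} :=
  a *: 'X - ((a *+ 2 + b) / l) *: 'X^2 + ((a + b) / l ^+ 2) *: 'X^3.

Lemma hermiteE l a b c : l != 0 ->
  (hermite l a b).[edge_end l c] = 0 /\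
  (deriv (hermite l a b)).[edge_end l c] = if c then b else a.
Proof.
move=> l0'; rewrite /hermite !(derivD, derivN, derivZ, derivX, derivXn) !hornerE.
by case: c => /=; rewrite ?hornerMn ?hornerXn; split; field.
Qed.

Lemma smooth_horner (P : {poly R}) : smooth (horner P).
Proof.
apply: (@smooth_family _ [set horner P | P in setT]); last by exists P.
  by move=> _ [r _ <-] x; exact: derivable_horner.
by move=> _ [r _ <-]; exists (deriv r) => //; exact: derivE.
Qed.

(** It remains to compare traces of [f] at two ends [p] and [p'] of a vertex. A
    function in the domain of S with outer derivatives 1 at [p], -1 at [p'] and
    0 elsewhere leaves, in the boundary sums, the difference of these traces. *)
Lemma adjoint_sub_schroedinger :
  adjoint (S_op q) `<=` schroedinger q maximal_domain.
Proof.
move=> [f g] fg; have [/= fl gl adj] := fg.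
have f2 : gsobolev 2 f.
  move=> e; apply/sobolev2P => //; split; first exact: fl.
  by eexists; exact: adjoint_is_wderiv fg.
have gf : gaeq g (schroedinger_fun f).
  move=> e; have := wderiv_aeq (l0 e) (adjoint_is_wderiv e fg).
  apply: filterS => x H xl; rewrite /schroedinger_fun /gwderiv H//; ring.
split => //=; split=> //; split; first exact: gsobolevW f2.
move=> p p' pp'; have [->//|npp'] := eqVneq p p'.
pose nu (r : edge G * bool) : R := (r == p)%:R - (r == p')%:R.
pose P e := hermite (len e) (- nu (e, false)) (nu (e, true)).
pose s : gfun G := fun e x => ((P e).[x])%:C%C.
have s2 : gsobolev 2 s by move=> e; apply: smooth_sobolev2 => //; exact: smooth_horner.
have s0 r : gtrace r s = 0.
  rewrite /gtrace trace_smooth//; last exact: smooth_horner.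
  by have [->] := @hermiteE (len r.1) (- nu (r.1, false)) (nu (r.1, true)) r.2 (lt0r_neq0 (l0 _)).
have s' r : outer_deriv r s = (nu r)%:C%C.
  rewrite /outer_deriv /gtrace /gwderiv trace_wderiv_smooth//; last exact: smooth_horner.
  rewrite -derivE.
  have [_ ->] := @hermiteE (len r.1) (- nu (r.1, false)) (nu (r.1, true)) r.2 (lt0r_neq0 (l0 _)).
  case: r => e []//=; by rewrite rmorphN opprK.
have sumnu (c : edge G * bool -> R[i]) :
    \sum_r (nu r)%:C%C * c r = c p - c p'.
  transitivity (\sum_r (if r == p then c r else 0) - \sum_r (if r == p' then c r else 0)).
    rewrite -sumrB; apply: eq_bigr => r _; rewrite /nu rmorphB /= mulrBl.
    by congr (_ - _); case: eqP => _; rewrite ?rmorph1 ?rmorph0 ?mul1r ?mul0r.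
  by rewrite -!big_mkcond !big_pred1_eq.
have Ds : minimal_domain s.
  split => //; first by split => [|r r' _]; [exact: gsobolevW s2|rewrite !s0].
  move=> v; split=> [r _|]; first exact: s0.
  rewrite normal_derivE big_mkcond /=.
  transitivity (\sum_r (nu r)%:C%C * (endpt r == v)%:R).
    by apply: eq_bigr => r _; rewrite s'; case: ifP => _; rewrite ?mulr1 ?mulr0.
  by rewrite sumnu pp' subrr.
have Ss : S_op q (s, schroedinger_fun s).
  split => //=; first exact: schroedinger_fun_L2.
  by move=> e; exact: aeq_refl.
have /eqP := adj _ _ Ss; rewrite -subr_eq0.
rewrite (inner_symmetry s2 f2 (schroedinger_fun_L2 s2) gl _ gf); last first.
  by move=> e; exact: aeq_refl.
rewrite [X in X - _]big1; last by move=> r _; rewrite s0 mulr0.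
have f1 := gsobolevW (isT : (1 <= 2)%N) f2.
rewrite (eq_bigr (fun r => (nu r)%:C%C * conjc (gtrace r f))); last first.
  by move=> r _; rewrite s' gtrace_conj.
rewrite sumnu sub0r oppr_eq0 subr_eq0 => /eqP.
exact: (can_inj (@conjcK R)).
Qed.

Theorem adjoint_S : adjoint (S_op q) = schroedinger q maximal_domain.
Proof.
apply/seteqP; split; [exact: adjoint_sub_schroedinger|exact: schroedinger_sub_adjoint].
Qed.

(** * The Krein and the standard extension *)

Definition gcst (c : R[i]) : gfun G := fun _ _ => c.

Lemma gsobolev_cst n c : gsobolev n (gcst c).
Proof. by move=> e; exact: sobolev_cst. Qed.

Lemma gtrace_cst p c : gtrace p (gcst c) = c.
Proof. by rewrite /gtrace trace_cst. Qed.

Lemma outer_deriv_cst p c : outer_deriv p (gcst c) = 0.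
Proof.
rewrite /outer_deriv (@gtrace_aeq p _ (gcst 0)) ?gtrace_cst ?oppr0 ?if_same//.
by move=> e; exact: wderiv_aeq (is_wderiv_cst _ _ _).
Qed.

Lemma normal_deriv_cst v c : normal_deriv (gcst c) v = 0.
Proof. by rewrite normal_derivE big1// => p _; exact: outer_deriv_cst. Qed.

Lemma gH1_cst c : gH1 (gcst c).
Proof. by split => [|p p' _]; [exact: gsobolev_cst|rewrite !gtrace_cst]. Qed.

Lemma minimal_op_dom s : op_dom (S_op q) s <-> minimal_domain s.
Proof. by apply: op_dom_schroedinger => -[]. Qed.

Lemma minimal_domain0 : minimal_domain (gcst 0).
Proof.
split; [exact: gsobolev_cst|exact: gH1_cst|move=> v; split=> [p _|]].
  exact: gtrace_cst.
exact: normal_deriv_cst.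
Qed.

Lemma adjoint_kerP k : op_ker (adjoint (S_op q)) k <->
  maximal_domain k /\ gaeq (schroedinger_fun k) (gcst 0).
Proof.
rewrite /op_ker adjoint_S; split=> [[/= km _ k0]|[km k0]].
  by split => // e; exact/aeq_sym/k0.
split=> //= [e|e]; first exact: L2_cst.
exact/aeq_sym/k0.
Qed.

Lemma standardE f g : standard_laplacian q (f, g) <->
  adjoint (S_op q) (f, g) /\ forall v, normal_deriv f v = 0.
Proof.
rewrite adjoint_S; split=> [[/= [f2 f1 f0] gl gf]|[[/= [f2 f1] gl gf] f0]].
  by split.
by split.
Qed.

Lemma gaeq_gcst_potential f : (forall e, aeq (len e) (fun x => (q e x)%:C%C) (fun=> 0)) ->
  gaeq (fun e x => (q e x)%:C%C * f e x) (gcst 0).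
Proof. by move=> q0 e; apply: filterS (q0 e) => x H xl; rewrite H// mul0r. Qed.

(** When [q] vanishes, the derivative of an element of the kernel is constant on
    each edge; the edges are loops, so its integral is zero. *)
Lemma flower_kernel_normal_deriv k v : flower G ->
  (forall e, aeq (len e) (fun x => (q e x)%:C%C) (fun=> 0)) ->
  op_ker (adjoint (S_op q)) k -> normal_deriv k v = 0.
Proof.
move=> flow q0 /adjoint_kerP[[k2 [k1 kc]] k0].
have /fintype1P[v1 Gv1] : #|vertex G| == 1%N by rewrite flow.
rewrite normal_derivE big1// => p _.
suff k'0 : gtrace p (gwderiv 1 k) = 0 by rewrite /outer_deriv k'0 oppr0 if_same.
set e := p.1.
have k''0 : aeq (len e) (wderiv (len e) 1 (wderiv (len e) 1 (k e))) (fun=> 0).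
  apply: aeq_trans (wderiv_wderiv (l0 e) (k2 e)) _.
  have := gaeq_gcst_potential k q0 e; apply: filterS2 (k0 e) => x H H' xl.
  have := H xl; rewrite /schroedinger_fun (H' xl) /gcst addr0 => /eqP.
  by rewrite oppr_eq0 => /eqP.
have kc' := wderiv_eq0_cst (l0 e) (sobolev_wderiv1 (k2 e)) k''0 p.2.
have := trace_cintegral (l0 e) (k1 e).
have := kc (e, true) (e, false); rewrite !Gv1 /gtrace /= => /(_ erefl) ->.
rewrite subrr (aeq_cintegral kc'); first last.
- exact/L2_cL1/L2_cst.
- exact/L2_cL1/(gsobolev_wderiv_L2 e (isT : (1 <= 2)%N) k2).
set c := trace _ _ _.
have -> : cintegral (len e) (fun=> c) = c * (len e)%:C%C.
  rewrite -(mulr1 c) (cintegralZ _ (L2_cL1 (L2_cst _ _))) mulr1; congr (_ * _).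
  by apply: complex_eqP; rewrite /= Rintegral_edge_cst ?mul1r ?mul0r// ltW.
move=> /eqP; rewrite mulf_eq0 => /orP[/eqP//|].
by rewrite (inj_eq (@complexI R) _ 0) gt_eqF.
Qed.

Lemma flower_krein_standard : flower G ->
  (forall e, aeq (len e) (fun x => (q e x)%:C%C) (fun=> 0)) ->
  krein_laplacian q = standard_laplacian q.
Proof.
move=> flow q0; apply/seteqP; split=> -[f g].
  move=> [/= fg [s [k [/minimal_op_dom[s2 _ sv] kk fsk]]]].
  apply/standardE; split => // v.
  have [[k2 _] _] := (adjoint_kerP k).1 kk.
  move: fg; rewrite adjoint_S => -[/= [f2 _] _ _].
  rewrite (normal_deriv_aeq v fsk); first last.
  - exact: gsobolevW f2.
  - by move=> e; apply: L2D; [exact: gsobolev_L2 s2 e|exact: gsobolev_L2 k2 e].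
  rewrite normal_derivD// (flower_kernel_normal_deriv v flow q0 kk) addr0.
  by case: (sv v).
move=> /standardE[fg f0]; split => //=.
have /fintype1P[v1 Gv1] : #|vertex G| == 1%N by rewrite flow.
have [/= [f2 [f1 fc]] _ _] : schroedinger q maximal_domain (f, g).
  by rewrite -adjoint_S.
have [e0 _] : exists e0 : edge G, e0 \in edge G.
  by apply/card_gt0P; exact: edge_gt0.
pose c := gtrace (e0, true) f.
exists (fun e x => f e x + gcst (- c) e x), (gcst c); split.
- apply/minimal_op_dom.
  have s2 : gsobolev 2 (fun e x => f e x + gcst (- c) e x).
    by move=> e; apply: sobolevD; [exact: f2|exact: gsobolev_cst].
  have s0 p : gtrace p (fun e x => f e x + gcst (- c) e x) = 0.
    rewrite gtraceD//; last exact: gsobolev_cst.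
    by rewrite gtrace_cst (fc p (e0, true)) ?subrr// !Gv1.
  split => //; first by split => [|p p' _]; [exact: gsobolevW s2|rewrite !s0].
  move=> v; split=> [p _|]; first exact: s0.
  by rewrite normal_derivD ?f0 ?normal_deriv_cst ?addr0//; exact: gsobolev_cst.
- apply/adjoint_kerP; split.
    by split; [exact: gsobolev_cst|exact: gH1_cst].
  move=> e; have := wderiv_aeq (l0 e) (is_wderiv_cst 1 c (l0 e)).
  apply: filterS2 (gaeq_gcst_potential (gcst c) q0 e) => x H H' xl.
  by rewrite /schroedinger_fun H// /gwderiv H'// oppr0 addr0.
- by move=> e; apply: aeq_eq => x _; rewrite /gcst subrK.
Qed.

Lemma Re_cintegral_sq_ge0 l (h : R -> R[i]) : L2 l h ->
  0 <= Re (cintegral l (fun x => h x * conjc (h x))) /\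
  (Re (cintegral l (fun x => h x * conjc (h x))) = 0 -> aeq l h (fun=> 0)).
Proof.
move=> hl; have [hr _] := cL1M hl (L2_conj hl).
have hge x : 0 <= Re (h x * conjc (h x)).
  by rewrite !ReImE mulrN opprK addr_ge0// -expr2 sqr_ge0.
have [|I0 I1] := Rintegral_eq0_ae hr; first by apply: aeW => x _; exact: hge.
split => // /I1; apply: filterS => x H xl.
have := H xl; rewrite /= !ReImE mulrN opprK -!expr2 => /eqP.
rewrite paddr_eq0 ?sqr_ge0// !sqrf_eq0 => /andP[/eqP hr0 /eqP hi0].
exact: complex_eqP.
Qed.

Lemma Re_sum (I : finType) (F : I -> R[i]) : Re (\sum_i F i) = \sum_i Re (F i).
Proof. by apply: (big_morph Re) => // a b; rewrite cReD. Qed.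

Hypothesis q_ge0 : forall e, {ae mu, forall x, edge_int (len e) x -> 0 <= q e x}.

(** With [1 = s + k] for some [s] in the domain of [S] and [k] in the kernel of
    [S*], the function [k] has trace 1 and normal derivative 0 at every
    vertex; so its energy, a sum of boundary terms, is zero. *)
Lemma krein_standard_potential : krein_laplacian q = standard_laplacian q ->
  forall e, aeq (len e) (fun x => (q e x)%:C%C) (fun=> 0).
Proof.
move=> KS e0.
have : krein_laplacian q (gcst 1, schroedinger_fun (gcst 1)).
  rewrite KS; split => /=.
  - split; [exact: gsobolev_cst|exact: gH1_cst|by move=> v; exact: normal_deriv_cst].
  - by apply: schroedinger_fun_L2; exact: gsobolev_cst.
  - by move=> e; exact: aeq_refl.
move=> [/= _ [s [k [/minimal_op_dom[s2 [s1 _] sv] /adjoint_kerP[[k2 [k1 kc]] k0] sk]]]].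
have k_trace p : gtrace p k = 1.
  rewrite -(gtrace_cst p 1) (gtrace_aeq p sk) gtraceD// (@vanishing_gtrace s) ?add0r//.
  by move=> v; case: (sv v).
have k_nd v : normal_deriv k v = 0.
  have := normal_deriv_cst v 1; rewrite (normal_deriv_aeq v sk); first last.
  - exact: gsobolev_cst.
  - by move=> e; apply: L2D; [exact: gsobolev_L2 s2 e|exact: gsobolev_L2 k2 e].
  by rewrite normal_derivD//; case: (sv v) => _ ->; rewrite add0r.
have kb1 := gsobolev_conj k1; have kl := gsobolev_L2 k2.
have qkl := potential_L2 kl.
have kb_l : gL2 (gconj k) by exact: gsobolev_L2 kb1.
have k'l e := gsobolev_wderiv_L2 e (isT : (1 <= 2)%N) k2.
have k''l e := gsobolev_wderiv_L2 e (isT : (2 <= 2)%N) k2.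
have k''E e : aeq (len e) (wderiv (len e) 2 (k e)) (fun x => (q e x)%:C%C * k e x).
  apply: filterS (k0 e) => x H xl; have := H xl.
  rewrite /schroedinger_fun /gwderiv /gcst addrC => /eqP.
  by rewrite subr_eq0 => /eqP.
pose A e := cintegral (len e) (fun x => wderiv (len e) 1 (k e) x * conjc (wderiv (len e) 1 (k e) x)).
pose B e := cintegral (len e) (fun x => (q e x)%:C%C * k e x * conjc (k e x)).
(* The real part of Green's identity for [k] and its conjugate. *)
have energy : \sum_e Re (A e) + \sum_e Re (B e) = 0.
  have := green k2 kb1; rewrite boundary_sum_eq0//; last first.
    by move=> p p' _; rewrite !gtrace_conj// !k_trace.
  rewrite sub0r (eq_bigr B); last first.
    by move=> e _; apply: aeq_cintegralM => //; exact: kb_l.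
  rewrite [X in _ = - X](eq_bigr A); last first.
    move=> e _; apply: aeq_cintegral.
    - apply: aeqM; first exact: aeq_refl.
      exact: (wderiv_conj (l0 e) (leqnn 1) (k1 e)).
    - by apply: cL1M => //; exact: gsobolev_wderiv_L2 kb1.
    - by apply: cL1M => //; exact: L2_conj.
  move=> /(congr1 Re); rewrite cReN !Re_sum => ->; exact: subrr.
have A0 e : 0 <= Re (A e) by have [] := Re_cintegral_sq_ge0 (k'l e).
have BE e : Re (B e) = Rintegral mu (edge_int (len e)) (fun x => q e x * (Re (k e x) ^+ 2 + Im (k e x) ^+ 2)).
  by apply: eq_Rintegral => x _; rewrite !ReImE /=; ring.
have BL e : L1 (len e) (fun x => q e x * (Re (k e x) ^+ 2 + Im (k e x) ^+ 2)).
  have [H _] := cL1M (qkl e) (L2_conj (kl e)).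
  by apply: L1_eq H => x _; rewrite /= !ReImE /=; ring.
have Bq e : {ae mu, forall x, edge_int (len e) x ->
    0 <= q e x * (Re (k e x) ^+ 2 + Im (k e x) ^+ 2)}.
  have := q_ge0 e; apply: filterS; first exact: (ae_filter_ringOfSetsType mu).
  by move=> x H xl; rewrite mulr_ge0 ?H// addr_ge0// sqr_ge0.
have BH e := Rintegral_eq0_ae (BL e) (Bq e).
have B0 e : 0 <= Re (B e) by rewrite BE; have [] := BH e.
move/eqP: energy; rewrite paddr_eq0 ?sumr_ge0// => /andP[/eqP sA /eqP sB].
have Ae0 : Re (A e0) = 0 by exact: (psumr_eq0P (fun e _ => A0 e) sA).
have Be0 : Re (B e0) = 0 by exact: (psumr_eq0P (fun e _ => B0 e) sB).
have k'0 : aeq (len e0) (wderiv (len e0) 1 (k e0)) (fun=> 0).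
  by have [_] := Re_cintegral_sq_ge0 (k'l e0); apply.
have kone := wderiv_eq0_cst (l0 e0) (k1 e0) k'0 true.
have := k_trace (e0, true); rewrite /gtrace /= => kt; rewrite kt in kone.
have [_ ] := BH e0; rewrite -BE => /(_ Be0).
apply: filterS2 kone => x H1 H2 xl.
by have := H2 xl; rewrite H1//= expr1n expr0n /= addr0 mulr1 => ->.
Qed.

(** The affine interpolation on the edges of the indicator function of [v]. *)
Definition hat v : gfun G := fun e x =>
  ((endpt (e, false) == v)%:R%:P +
   (((endpt (e, true) == v)%:R - (endpt (e, false) == v)%:R) / len e) *: 'X : {poly R}).[x]%:C%C.

(** At an end located at [v], the outer derivative of [hat v] is [1 / len e] if
    the other end of the edge is not at [v], and 0 otherwise; these terms are
    nonnegative and add up to the normal derivative, which is zero. *)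
Lemma krein_standard_loops : krein_laplacian q = standard_laplacian q ->
  (forall e, aeq (len e) (fun x => (q e x)%:C%C) (fun=> 0)) ->
  forall v p, endpt p = v -> endpt (p.1, ~~ p.2) = v.
Proof.
move=> KS q0 v.
pose d (e : edge G) : R := ((endpt (e, true) == v)%:R - (endpt (e, false) == v)%:R) / len e.
pose P e : {poly R} := (endpt (e, false) == v)%:R%:P + d e *: 'X.
have dP e : deriv (P e) = (d e)%:P.
  by rewrite /P derivD derivC add0r derivZ derivX alg_polyC.
have sP e : smooth (horner (P e)) := @smooth_horner (P e).
have hatE e : hat v e = fun x => ((P e).[x])%:C%C by [].
have h2 : gsobolev 2 (hat v) by move=> e; rewrite hatE; apply: smooth_sobolev2; [exact: l0|exact: sP].
have ht p : gtrace p (hat v) = (endpt p == v)%:R.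
  rewrite /gtrace hatE trace_smooth// -[RHS](rmorph_nat (real_complex R)).
  congr (_%:C%C); rewrite /edge_end /P /d !hornerE.
  case: p => e []/=; last by rewrite mulr0 addr0.
  by rewrite divfK ?gt_eqF// addrC subrK.
have h' p : outer_deriv p (hat v) = ((if p.2 then d p.1 else - d p.1))%:C%C.
  have E : gtrace p (gwderiv 1 (hat v)) = (d p.1)%:C%C.
    rewrite /gtrace /gwderiv hatE trace_wderiv_smooth// -derivE dP.
    by rewrite hornerC.
  by rewrite /outer_deriv E; case: ifP => // _; rewrite rmorphN.
have h'' e : aeq (len e) (gwderiv 2 (hat v) e) (fun=> 0).
  apply: aeq_trans (wderiv_aeq (l0 e) (smooth_wderiv2 (l0 e) (sP e))) _.
  by apply: aeq_eq => x _; rewrite -!derivE dP derivC horner0.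
have kerh : op_ker (adjoint (S_op q)) (hat v).
  apply/adjoint_kerP; split.
    split=> //; split; first exact: gsobolevW h2.
    by move=> p p' pp'; rewrite !ht pp'.
  move=> e; apply: filterS2 (gaeq_gcst_potential (hat v) q0 e) (h'' e) => x H H' xl.
  by rewrite /schroedinger_fun H// H'// oppr0 addr0.
have : krein_laplacian q (hat v, fun _ _ => 0).
  split; first exact: kerh.
  exists (gcst 0), (hat v); split => //.
    exact/minimal_op_dom/minimal_domain0.
  by move=> e; apply: aeq_eq => x _; rewrite /gcst add0r.
rewrite KS => /standardE[_ /(_ v)].
pose r p : R := if p.2 then d p.1 else - d p.1.
rewrite normal_derivE (eq_bigr (fun p => (r p)%:C%C)); last by move=> p _; exact: h'.
rewrite -(rmorph_sum (real_complex R)) => /(@complexI R _ 0) r0.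
have rE p : endpt p = v -> r p = (endpt (p.1, ~~ p.2) != v)%:R / len p.1.
  case: p => e []/= pv; rewrite /r /d /= pv eqxx.
    by congr (_ / _); case: eqP => _; rewrite ?subrr ?subr0.
  by rewrite -mulNr opprB; congr (_ / _); case: eqP => _; rewrite ?subrr ?subr0.
have r_ge0 p : endpt p == v -> 0 <= r p.
  by move=> /eqP /rE ->; rewrite divr_ge0// ltW.
move=> p /[dup] pv /eqP /(psumr_eq0P r_ge0 r0).
rewrite rE// => /eqP; rewrite mulf_eq0 invr_eq0 (gt_eqF (l0 _)) orbF.
by rewrite pnatr_eq0 eqb0 negbK => /eqP.
Qed.

Lemma loops_flower : graph_connected G ->
  (forall v p, endpt p = v -> endpt (p.1, ~~ p.2) = v) -> flower G.
Proof.
move=> conn loops.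
have adjE (v w : vertex G) : Defs.adjacent v w -> v = w.
  move=> /existsP[e /orP[]/andP[/eqP ev /eqP ew]].
    by have := loops v (e, false) ev; rewrite /= ew.
  by have := loops w (e, false) ev; rewrite /= ew.
have eqv (v w : vertex G) : v = w.
  have /connectP[r + ->] := conn v w.
  by elim: r v => //= a r IH v /andP[/adjE -> /IH].
have [e0 _] : exists e0 : edge G, e0 \in edge G.
  by apply/card_gt0P; exact: edge_gt0.
by apply/eqP/fintype1P; exists (endpt (e0, true)) => v; exact: eqv.
Qed.

Lemma krein_standardP : graph_connected G ->
  (krein_laplacian q = standard_laplacian q <->
   flower G /\ forall e, aeq (len e) (fun x => (q e x)%:C%C) (fun=> 0)).
Proof.
move=> conn; split=> [KS|[flow q0]]; last exact: flower_krein_standard.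
have q0 := krein_standard_potential KS; split => //.
exact/loops_flower/krein_standard_loops.
Qed.

End Graph.


(** * Measurable potentials *)

Section BorelRepresentative.
Variable R : realType.
Local Notation mu := (@lebesgue_measure R).
Implicit Types (l : R) (u : R -> R).

Lemma ae_impl2 (P Q S : R -> Prop) : (forall x, P x -> Q x -> S x) ->
  {ae mu, forall x, P x} -> {ae mu, forall x, Q x} -> {ae mu, forall x, S x}.
Proof.
move=> PQS aP aQ; have FF := ae_filter_ringOfSetsType mu.
exact: (@filterS2 _ _ FF _ _ _ PQS aP aQ).
Qed.

(** For each rational [r] the set where [u] exceeds [r] is Borel up to a null
    set; [u'] is [u] set to 0 on a Borel null set [M] that contains all these
    exceptional sets. *)
Lemma Borel_representative l u : lebesgue_measurable_on l u ->
  exists u' : R -> R,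
    [/\ measurable_fun (edge_int l) u',
        {ae mu, forall x, edge_int l x -> u' x = u x} &
        forall x, u' x = u x \/ u' x = 0].
Proof.
move=> mu_; set D := edge_int l.
pose r n : R := ratr (odflt 0 (unpickle n)).
have AN n : exists AN : set R * set R,
    [/\ measurable AN.1, measurable AN.2, mu AN.2 = 0%E,
        AN.1 `<=` D `&` u @^-1` `]r n, +oo[ &
        D `&` u @^-1` `]r n, +oo[ `<=` AN.1 `|` AN.2].
  have mD : (completed_algebra_gen mu).-sigma.-measurable D.
    apply: sub_sigma_algebra; exists D; first exact: measurable_edge_intR.
    by exists set0; [exact: negligible_set0|rewrite setU0].
  have := mu_ mD `]r n, +oo[%classic (measurable_itv _).
  move=> H; have : (completed_algebra_gen mu).-sigma.-measurable (D `&` u @^-1` `]r n, +oo[).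
    exact: H.
  rewrite g_sigma_completed_algebra_genE => -[A mA [N [M [mM M0 NM]] ANE]].
  exists (A, M); split => //=; rewrite -ANE; first exact: subsetUl.
  exact: setUS.
have [F HF] := choice AN.
pose A n := (F n).1; pose M := \bigcup_n (F n).2.
have mA n : measurable (A n) by have [] := HF n.
have mM : measurable M by apply: bigcupT_measurable => n; have [] := HF n.
have M0 : mu.-negligible M.
  apply: negligible_bigcup => n; exists (F n).2; split => //; by have [] := HF n.
exists (fun x => if x \in M then 0 else u x); split.
- move=> mD; apply: (measurability _ (RGenOInfty.measurableE R)) => //.
  move=> /= _ [_ [a ->] <-].
  rewrite (_ : _ `&` _ = (if a < 0 then D `&` M else set0) `|`
     \bigcup_n (if a < r n then A n `\` M else set0)).
    apply: measurableU; first by case: ifP => // _; apply: measurableI; [exact: measurable_edge_int|exact: mM].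
    apply: bigcupT_measurable => n; case: ifP => // _; exact: measurableD.
  apply/seteqP; split=> y /=; rewrite in_itv /= andbT.
    move=> [yD]; case: ifPn => [/set_mem yM a0|yM ay]; first by left; rewrite a0.
    right; have [p] := rat_in_itvoo ay; rewrite in_itv /= => /andP[ap py].
    exists (pickle p) => //; have rp : r (pickle p) = ratr p by rewrite /r pickleK.
    rewrite rp ap; have [_ _ _ _ /(_ y)] := HF (pickle p).
    case=> [|yA|yM']; first by split => //=; rewrite in_itv /= rp py.
      by split => //; move/negP: yM => + My; apply; exact/mem_set.
    by exfalso; move/negP: yM; apply; apply/mem_set; exists (pickle p).
  move=> [|[n _]]; case: ifP => // an.
    by move=> [yD yM]; split => //; rewrite mem_set.
  move=> [yA yM]; have [_ _ _ /(_ y yA)[yD]] := HF n.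
  rewrite /= in_itv /= andbT => ry _; split => //.
  by rewrite memNset// (lt_trans an).
- apply: negligibleS M0 => x /= H; apply: contrapT => xM; apply: H => _.
  by rewrite memNset.
- by move=> x; case: ifP; [right|left].
Qed.

End BorelRepresentative.

Lemma schroedinger_aeq (R : realType) (G : metric_graph R)
    (q q' : edge G -> R -> R) (D : set (gfun G)) :
  (forall e, ae_eq (@lebesgue_measure R) (edge_int (len e)) (q e) (q' e)) ->
  schroedinger q D `<=` schroedinger q' D.
Proof.
move=> qq' [f g] [/= Df gl gf]; split => //= e.
by apply: filterS2 (gf e) (qq' e) => x H H' xl; rewrite H// H'.
Qed.

Lemma schroedinger_aeqE (R : realType) (G : metric_graph R)
    (q q' : edge G -> R -> R) (D : set (gfun G)) :
  (forall e, ae_eq (@lebesgue_measure R) (edge_int (len e)) (q e) (q' e)) ->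
  schroedinger q D = schroedinger q' D.
Proof.
move=> qq'; apply/seteqP; split; apply: schroedinger_aeq => // e.
by apply: filterS (qq' e) => x H xl; rewrite H.
Qed.

Theorem corollary3p9 (R : realType) (G : metric_graph R)
    (q : edge G -> R -> R) :
  graph_connected G ->
  (forall e, lebesgue_measurable_on (len e) (q e)) ->
  (exists M : R, forall e x, edge_int (len e) x -> `|q e x| <= M) ->
  (forall e, {ae @lebesgue_measure R, forall x,
                edge_int (len e) x -> 0 <= q e x}) ->
  (krein_laplacian q = standard_laplacian q <->
   flower G /\
   forall e, {ae @lebesgue_measure R, forall x,
                edge_int (len e) x -> q e x = 0}).
Proof.
move=> conn mq [M qM] q_ge0.
have [q' Hq'] := choice (fun e => Borel_representative (mq e)).
have q'm e : measurable_fun (edge_int (len e)) (q' e) by case: (Hq' e).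
have qq' e : ae_eq (@lebesgue_measure R) (edge_int (len e)) (q e) (q' e).
  have [_ q'e _] := Hq' e; apply: (ae_impl2 _ q'e q'e) => x H _ xl; by rewrite H.
have q'b : exists M : R, forall e x, edge_int (len e) x -> `|q' e x| <= M.
  exists M => e x xl; have [_ _ /(_ x)[->|->]] := Hq' e; first exact: qM xl.
  by rewrite normr0 (le_trans _ (qM e x xl)).
have q'_ge0 e : {ae @lebesgue_measure R, forall x,
    edge_int (len e) x -> 0 <= q' e x}.
  by apply: ae_impl2 (qq' e) (q_ge0 e) => x H H' xl; rewrite -H// H'.
rewrite /krein_laplacian /standard_laplacian /S_op.
rewrite (schroedinger_aeqE _ qq') [in RHS](schroedinger_aeqE _ qq').
rewrite -/(S_op q') -/(standard_laplacian q') -/(krein_laplacian q').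
apply: iff_trans (krein_standardP q'm q'b q'_ge0 conn) _.
split=> -[flow q0]; split=> // e.
  apply: ae_impl2 (qq' e) (q0 e) => x H H' xl.
  by rewrite H//; apply: (@complexI R); rewrite H'.
by apply: ae_impl2 (qq' e) (q0 e) => x H H' xl; rewrite -H// H'.
Qed.
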